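(* The probability of satisfiability $\Phi(d_1,d_3)$ that a random formula from $H^3_{n,d_1,0,d_3}$ is satisfiable (in the limit $n\to\infty$) is continuous for $d_3<2$ and discontinuous for $d_3>2$. Its discontinuities are given by a curve $\Gamma$ in the $(d_1,d_3)$ plane described by the equation $$d_1 = 1 - \frac{\exp\left(\frac14\left(\sqrt{d_3}-\sqrt{d_3-2}\right)^2\right)}{d_3-\sqrt{d_3(d_3-2)}} .$$ This curve consists of the points $(d_1,d_3)$ at which $t_0$ is a double root of the equation $$\ln\frac{1-t}{1-d_1} + d_3 t^2 = 0,$$ where $t_0$ denotes the smallest positive root of this equation, and the curve ends at the critical point $$\left(1-\sqrt{e}/2,\ 2\right) = (0.1756\ldots,\ 2).$$
   Context: A Horn clause is a disjunction of literals of which at most one is positive; a Horn-SAT formula is a conjunction of Horn clauses. For nonnegative real numbers $d_1,d_3$ with $d_1<1$, the random Horn-SAT formula $H^3_{n,d_1,0,d_3}$ on Boolean variables $x_1,\ldots,x_n$ is the conjunction of: (1) a single negative literal $\overline{x}_1$; (2) $d_1 n$ positive literals chosen uniformly without replacement from $x_2,\ldots,x_n$; and (3) $d_3 n$ clauses chosen uniformly from the $3\binom{n}{3}$ possible Horn clauses with $3$ variables where one literal is positive. (There are no clauses of length 2.) The function $\Phi$ is $\Phi(d_1,d_3)=\lim_{n\to\infty}\Pr[H^3_{n,d_1,0,d_3}\text{ is satisfiable}]$. The root $t_0$ is called a double root if the derivative of the left-hand side of the equation with respect to $t$ is zero at $t_0$.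
   Formalization: The description of Γ by double roots is stated for points with d1 > 0; at d1 = 0 it fails at the point (0, 2.455…), where the smallest positive root is double although the point is not on Γ. *)

(* Defs.v *)
From HB Require Import structures.
From mathcomp Require Import all_boot all_order all_algebra.
From mathcomp Require Import all_classical all_reals all_analysis.
Import Order.TTheory GRing.Theory Num.Theory.
Import numFieldNormedType.Exports.

Set Implicit Arguments.
Unset Strict Implicit.
Unset Printing Implicit Defensive.

Section Formulas.

Variable n : nat.

(* (i, true) is the literal x_i and (i, false) its negation. *)
Definition literal := ('I_n * bool)%type.
Definition clause := {set literal}.
Definition formula := seq clause.

Definition clause_holds (s : {ffun 'I_n -> bool}) (c : clause) : bool :=
  [exists l in c, s l.1 == l.2].

Definition satisfiable (f : formula) : bool :=
  [exists s : {ffun 'I_n -> bool}, all (clause_holds s) f].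

Definition clause_vars (c : clause) : {set 'I_n} := [set l.1 | l in c]%SET.
Definition positive_part (c : clause) : clause := [set l in c | l.2]%SET.

Definition horn_clause (c : clause) : bool := (#|positive_part c| <= 1)%N.

Definition horn3 : {set clause} :=
  [set c : clause |
    [&& #|c| == 3, #|clause_vars c| == 3 & #|positive_part c| == 1]]%SET.

Lemma horn3_horn (c : clause) : c \in horn3 -> horn_clause c.
Proof. by rewrite inE /horn_clause => /and3P[_ _ /eqP->]. Qed.

Let mk (p : {set 'I_n} * 'I_n) : clause := [set (j, j == p.2) | j in p.1]%SET.
Let marked : {set {set 'I_n} * 'I_n} :=
  [set p : {set 'I_n} * 'I_n | (#|p.1| == 3) && (p.2 \in p.1)]%SET.

Let mem_mk p l : (l \in mk p) = (l.1 \in p.1) && (l.2 == (l.1 == p.2)).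
Proof.
apply/imsetP/andP => [[j jp ->]|[lp /eqP l2]]; first by rewrite eqxx.
by exists l.1 => //; rewrite -l2; case: l {lp l2}.
Qed.

Let mk_inj : {in marked &, injective mk}.
Proof.
move=> [A i] [B j]; rewrite !inE /= => /andP[_ iA] /andP[_ jB] e.
have AB : A = B.
  apply/setP => k; apply/idP/idP => kA.
    have : (k, k == i) \in mk (A, i) by rewrite mem_mk /= kA eqxx.
    by rewrite e mem_mk => /andP[].
  have : (k, k == j) \in mk (B, j) by rewrite mem_mk /= kA eqxx.
  by rewrite -e mem_mk => /andP[].
have : (i, true) \in mk (A, i) by rewrite mem_mk /= iA eqxx.
by rewrite e mem_mk /= AB => /andP[_ /eqP/esym/eqP->].
Qed.

Let mk_horn3 : horn3 = (mk @: marked)%SET.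
Proof.
apply/setP => c; apply/idP/imsetP => [|[[A i] + ->]].
  rewrite inE => /and3P[/eqP c3 /eqP v3 /cards1P[[i b] cib]].
  have /setIdP[ic /= bT] : (i, b) \in positive_part c by rewrite cib set11.
  rewrite {b}bT in cib ic.
  have inj : {in c &, injective (@fst 'I_n bool)}.
    by apply/imset_injP; rewrite -/(clause_vars c) v3 c3.
  exists (clause_vars c, i).
    by rewrite inE /= v3 eqxx /=; apply/imsetP; exists (i, true).
  apply/setP => -[k b]; rewrite mem_mk /=; apply/idP/andP => [kc|[]].
    split; first by apply/imsetP; exists (k, b).
    have : ((k, b) \in positive_part c) = b by rewrite inE kc.
    rewrite cib inE xpair_eqE; case: b kc => kc; first by rewrite andbT => ->.
    case: eqP => //= ki _; move: kc; rewrite ki => kc.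
    by have [] : (i, false) = (i, true) by apply: inj.
  move=> /imsetP[[k' b'] /= kc ->] {k} /eqP->.
  suff -> : (k' == i) = b' by [].
  have : ((k', b') \in positive_part c) = b' by rewrite inE kc.
  rewrite cib inE xpair_eqE; case: b' kc => kc; first by rewrite andbT => ->.
  case: eqP => //= ki _; move: kc; rewrite ki => kc.
  by have [] : (i, false) = (i, true) by apply: inj.
rewrite !inE /= => /andP[/eqP A3 iA].
have vA : clause_vars (mk (A, i)) = A.
  apply/setP => k; apply/imsetP/idP => [[l + ->]|kA].
    by rewrite mem_mk => /andP[].
  by exists (k, k == i) => //; rewrite mem_mk /= kA eqxx.
apply/and3P; split.
- by rewrite /mk card_imset ?A3// => x y [].
- by rewrite vA A3.
- apply/cards1P; exists (i, true); apply/setP => -[k b].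
  rewrite !inE mem_mk /= xpair_eqE; case: b; rewrite ?andbF ?andbT//.
  by rewrite eq_sym eqb_id; case: eqP => [->|]; rewrite ?iA ?andbF.
Qed.

Lemma card_horn3 : #|horn3| = (3 * 'C(n, 3))%N.
Proof.
rewrite mk_horn3 card_in_imset//.
have -> : #|marked| = (\sum_(A : {set 'I_n} | #|A| == 3) \sum_(i in A) 1)%N.
  rewrite pair_big_dep /= sum1_card; apply: eq_card => p.
  by rewrite !inE.
rewrite (eq_bigr (fun=> 3)) => [|A /eqP A3]; last by rewrite sum1_card A3.
rewrite sum_nat_const mulnC; congr (_ * _)%N.
rewrite -[in RHS](card_ord n) -card_draws; apply: eq_card => A.
by rewrite !inE.
Qed.

End Formulas.

Section RandomHornSat.

(* There are n.+1 variables, so that the distinguished variable is ord0.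
   An outcome consists of the set of the k positive unit clauses and of the
   list of the m clauses of length 3; the latter are drawn independently. *)
Definition outcomes (n k m : nat) :
    {set {set 'I_n.+1} * m.-tuple (clause n.+1)} :=
  [set w : {set 'I_n.+1} * m.-tuple (clause n.+1) |
    [&& ord0 \notin w.1, #|w.1| == k & all [in horn3 n.+1] w.2]]%SET.

Definition horn_formula (n m : nat)
    (w : {set 'I_n.+1} * m.-tuple (clause n.+1)) : formula n.+1 :=
  [set (ord0, false)]%SET ::
    [seq [set (i, true)]%SET | i <- enum w.1] ++ w.2.

Local Open Scope ring_scope.

Variable R : realType.

Definition sat_ratio (n k m : nat) : R :=
  #|[set w in outcomes n k m | satisfiable (horn_formula w)]%SET|%:R
  / #|outcomes n k m|%:R.

(* The numbers of clauses d1 * N and d3 * N are rounded down, N = n.+1. *)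
Definition sat_prob (d1 d3 : R) (n : nat) : R :=
  sat_ratio n (Num.truncn (d1 * n.+1%:R)) (Num.truncn (d3 * n.+1%:R)).

End RandomHornSat.

Local Open Scope classical_set_scope.
Local Open Scope ring_scope.

Section Phase.

Variable R : realType.
Implicit Types (t : R) (p : R * R).

Definition parameters : set (R * R) := [set p | 0 <= p.1 < 1 /\ 0 <= p.2].

(* Convergence of the probabilities is not built in: Phi p only has to be an
   accumulation point, hence is the limit whenever the limit exists. *)
Definition limiting_sat_prob (Phi : R * R -> R) : Prop :=
  forall p, parameters p -> cluster (sat_prob p.1 p.2 @ \oo) (Phi p).

Definition continuous_in (D : set (R * R)) (f : R * R -> R) p : Prop :=
  f @ within D (nbhs p) --> f p.

Definition lhs (d1 d3 : R) t : R := ln ((1 - t) / (1 - d1)) + d3 * t ^+ 2.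

(* t < 1 is the domain of the logarithm (ln is 0 on nonpositive reals). *)
Definition is_root (d1 d3 : R) t : Prop := t < 1 /\ lhs d1 d3 t = 0.

Definition smallest_positive_root (d1 d3 : R) t : Prop :=
  [/\ 0 < t, is_root d1 d3 t & forall s, 0 < s -> is_root d1 d3 s -> t <= s].

Definition double_root (d1 d3 : R) t : Prop :=
  is_root d1 d3 t /\ is_derive t 1 (lhs d1 d3) 0.

Definition Gamma_d1 (d3 : R) : R :=
  1 - expR (4^-1 * (Num.sqrt d3 - Num.sqrt (d3 - 2)) ^+ 2)
      / (d3 - Num.sqrt (d3 * (d3 - 2))).

(* The right-hand side of the equation is only real for d3 >= 2. *)
Definition Gamma : set (R * R) := [set p | 2 <= p.2 /\ p.1 = Gamma_d1 p.2].

Definition critical_point : R * R := (1 - Num.sqrt (expR 1) / 2, 2).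

End Phase.

Arguments parameters R p : clear implicits.
Arguments Gamma R p : clear implicits.

(* Main.v *)
(* Encode a clause by a triple (u, v, h): body {u, v}, head h. With independent
   uniform triples on N variables, explore the closure of the set K of unit
   clauses one variable at a time, always taking a variable already derived if
   there is one. Replacing the body variables by the times of their exploration
   is a bijection, so the times and the heads are again independent and uniform.
   Hence the size of the closure is distributed as the first s for which the set
   D_s, made of K and of the heads of the clauses both of whose times are < s, has
   at most s elements. By Chebyshev |D_s| / N is close to
   1 - (1 - d1) exp (- d3 (s / N)^2), which brings in the equation of the roots.
   Conditioning on all triples having distinct entries, an event of probability
   bounded below, gives the actual model, where by symmetry the probability of
   satisfiability is the expected number of underived variables divided by N - k.
   The limit is therefore (1 - t) / (1 - d1), where t is the point at which
   (1 - t) exp (d3 t^2) first goes below 1 - d1. It jumps exactly when 1 - d1 is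
   the value of this function at a strict local minimum, i.e. on the curve. *)
Require Import Defs.
From mathcomp Require Import all_boot perm.

Set Implicit Arguments.
Unset Strict Implicit.
Unset Printing Implicit Defensive.

(** * Exploration of the Horn closure *)

Section Exploration.

Variable n : nat.
Local Notation V := 'I_n.+1.
Local Notation triple := (V * V * V)%type.
Implicit Types (K X A S : {set V}) (w : seq triple) (D : nat -> {set V}).

Definition horn_closed K w X : bool :=
  (K \subset X) &&
  all (fun t : triple => (t.1.1 \in X) && (t.1.2 \in X) ==> (t.2 \in X)) w.

Definition horn_closure K w : {set V} :=
  [set v | [forall X : {set V}, horn_closed K w X ==> (v \in X)]].

Lemma horn_closure_sub K w X : horn_closed K w X -> horn_closure K w \subset X.
Proof.
by move=> KX; apply/subsetP => v; rewrite inE => /forallP/(_ X)/implyP; exact.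
Qed.

Lemma sub_horn_closure K w S :
  (forall X, horn_closed K w X -> S \subset X) -> S \subset horn_closure K w.
Proof.
move=> h; apply/subsetP => v vS; rewrite inE; apply/forallP => X.
by apply/implyP => /h/subsetP; exact.
Qed.

(** The fallback to an arbitrary unexplored variable keeps the exploration going after [A] is
    exhausted, so that every variable gets a time. The default [ord0] occurs only when [S] is
    everything. *)
Definition next A S : V :=
  if [pick x in A :\: S] is Some x then x else odflt ord0 [pick x in ~: S].

Lemma next_notin A S : S != setT -> next A S \notin S.
Proof.
move=> ST; rewrite /next; case: pickP => [x|_]; first by rewrite inE => /andP[].
case: pickP => [x|S0] /=; first by rewrite inE.
by case/eqP: ST; apply/setP => x; have := S0 x; rewrite !inE => /negbFE.
Qed.

Lemma next_in A S : ~~ (A \subset S) -> next A S \in A.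
Proof.
case/subsetPn => x xA xS; rewrite /next; case: pickP => [y|/(_ x)].
  by rewrite inE => /andP[].
by rewrite inE xA xS.
Qed.

Fixpoint explored D s : {set V} :=
  if s is j.+1 then next (D j) (explored D j) |: explored D j else set0.

Definition visit D s : V := next (D s) (explored D s).

Lemma card_explored D s : s <= n.+1 -> #|explored D s| = s.
Proof.
elim: s => [_|s IHs sn] /=; first by rewrite cards0.
rewrite cardsU1 IHs ?(ltnW sn)// next_notin//.
by apply/eqP => ST; move: (sn); rewrite -[s in s < _]IHs ?(ltnW sn)// ST cardsT card_ord ltnn.
Qed.

Lemma visit_notin D s : s < n.+1 -> visit D s \notin explored D s.
Proof.
move=> sn; apply: next_notin; apply/eqP => ST; move: (sn).
by rewrite -[s in s < _](card_explored D (ltnW sn)) ST cardsT card_ord ltnn.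
Qed.

Lemma explored_mono D i j : i <= j -> explored D i \subset explored D j.
Proof.
move=> /subnK <-; elim: (j - i) => [|k IHk]; first by rewrite add0n.
by rewrite addSn /=; apply: subset_trans IHk (subsetUr _ _).
Qed.

Lemma visit_explored D i s : i < n.+1 -> (visit D i \in explored D s) = (i < s).
Proof.
move=> iN; apply/idP/idP => [|lt_is]; last first.
  by apply: (subsetP (explored_mono D lt_is)); rewrite /= setU11.
apply: contraTT; rewrite -leqNgt => le_si.
by apply: contra (visit_notin D iN); apply/subsetP/explored_mono.
Qed.

Lemma mem_exploredP D s v :
  v \in explored D s -> exists2 j, j < s & v = visit D j.
Proof.
elim: s => [|s IHs] /=; first by rewrite inE.
rewrite in_setU1 => /orP[/eqP->|/IHs[j js ->]]; first by exists s.
by exists j => //; apply: ltnW.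
Qed.

(** A variable visited earlier is already explored at any later moment. The visits thus permute the
    variables, and times can replace variables without loss. *)
Lemma visit_inj D : injective (fun i : V => visit D i).
Proof.
have lt_neq (i j : V) : i < j -> visit D i != visit D j.
  move=> ij; apply: contraTneq (visit_notin D (ltn_ord j)) => <-.
  by rewrite visit_explored// negbK.
move=> i j /eqP eij; apply: val_inj; have [/lt_neq|/lt_neq|//] := ltngtP i j.
  by rewrite eij.
by rewrite eq_sym eij.
Qed.

(* In a triple of times and a head, the first two entries are the moments at
   which the two variables of the body get explored. *)
Definition fired K w s : {set V} :=
  K :|: [set v | has (fun t : triple => [&& t.1.1 < s, t.1.2 < s & t.2 == v]) w].

Definition relabel_triple K w (t : triple) : triple :=
  (visit (fired K w) t.1.1, visit (fired K w) t.1.2, t.2).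

Lemma fired_mono K w i j : i <= j -> fired K w i \subset fired K w j.
Proof.
move=> ij; apply: setUS; apply/subsetP => v; rewrite !inE.
case/hasP => t tw /and3P[ti1 ti2 tv]; apply/hasP; exists t => //.
by rewrite (leq_trans ti1) ?(leq_trans ti2).
Qed.

(** A time lies below [s] exactly when the variable visited then is explored by step [s]. Hence
    times can be eliminated in favour of the relabelled triples and the current explored set. *)
Lemma fired_relabel K w s : fired K w s = K :|: [set v |
  has (fun t : triple => [&& t.1.1 \in explored (fired K w) s,
                    t.1.2 \in explored (fired K w) s & t.2 == v])
      (map (relabel_triple K w) w)].
Proof.
congr (_ :|: _); apply/setP => v; rewrite !inE has_map; apply: eq_has => t /=.
by rewrite !visit_explored ?ltn_ord.
Qed.

(* The exploration only depends on the relabelled triples, from which the times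
   can therefore be read off. *)
Lemma relabel_inj K w1 w2 :
  map (relabel_triple K w1) w1 = map (relabel_triple K w2) w2 -> w1 = w2.
Proof.
move=> ew.
have eE s : explored (fired K w1) s = explored (fired K w2) s.
  by elim: s => //= s IHs; rewrite fired_relabel IHs ew -fired_relabel.
have eV s : visit (fired K w1) s = visit (fired K w2) s.
  by rewrite /visit eE fired_relabel eE ew -fired_relabel.
have eR : relabel_triple K w1 =1 relabel_triple K w2.
  by move=> t; rewrite /relabel_triple !eV.
move: ew; rewrite (eq_map eR); apply: inj_map => -[[a b] h] [[a' b'] h'].
by case=> /(@visit_inj _ a a')-> /(@visit_inj _ b b')-> ->.
Qed.

Lemma fired_sub_closed K w s X :
  horn_closed K (map (relabel_triple K w) w) X ->
  explored (fired K w) s \subset X -> fired K w s \subset X.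
Proof.
move=> /andP[KX /allP hX] sX; rewrite fired_relabel subUset KX /=.
apply/subsetP => v; rewrite inE => /hasP[t tw /and3P[t1 t2 /eqP<-]].
by have /implyP := hX t tw; apply; rewrite !(subsetP sX).
Qed.

(** As long as [j < #|fired K w j|], the next visit goes to a fired variable; by induction all
    explored variables lie in every closed set. *)
Lemma leq_card_closure K w s : s <= n.+1 ->
  (forall j, j < s -> j < #|fired K w j|) ->
  s <= #|horn_closure K (map (relabel_triple K w) w)|.
Proof.
move=> sn hs; rewrite -[s in s <= _](card_explored (fired K w) sn).
apply/subset_leq_card/sub_horn_closure => X hX.
have: forall j, j <= s -> explored (fired K w) j \subset X; last exact.
elim=> [_|j IHj js] /=; first exact: sub0set.
have jX := IHj (ltnW js); rewrite subUset jX andbT sub1set.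
apply: (subsetP (fired_sub_closed hX jX)); apply: next_in.
apply/negP => /subset_leq_card; rewrite leqNgt card_explored ?hs//.
by rewrite (leq_trans (ltnW js)).
Qed.

(** At the first [j] with [#|fired K w j| <= j], all visits so far went to fired variables. Hence
    the explored set is contained in the fired set and, by cardinality, equals it; such a set is
    closed. *)
Lemma card_closure_leq K w s : s <= n.+1 -> #|fired K w s| <= s ->
  #|horn_closure K (map (relabel_triple K w) w)| <= s.
Proof.
move=> sn Ds; have ex : exists j, #|fired K w j| <= j by exists s.
have [j jD jmin] := ex_minnP ex; have js : j <= s := jmin _ Ds.
apply: leq_trans js; have jn := leq_trans (jmin _ Ds) sn.
rewrite -[j in _ <= j](card_explored (fired K w) jn); apply/subset_leq_card.
have eD : explored (fired K w) j = fired K w j.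
  apply/eqP; rewrite eqEcard card_explored// jD andbT.
  apply/subsetP => v /mem_exploredP[i ij ->].
  apply: (subsetP (fired_mono K w (ltnW ij))); apply: next_in.
  apply/negP => /subset_leq_card; rewrite card_explored; last first.
    by rewrite (leq_trans (ltnW ij)).
  by move/jmin; rewrite leqNgt ij.
apply: horn_closure_sub; rewrite /horn_closed {1}eD subsetUl /=.
apply/allP => t tw; apply/implyP => /andP[t1 t2].
rewrite eD fired_relabel inE; apply/orP; right; rewrite inE.
by apply/hasP; exists t => //; rewrite t1 t2 eqxx.
Qed.

End Exploration.

(** * Clauses as triples *)

Lemma card_tuple_forall (T : finType) m (P : 'I_m -> pred T) :
  #|[set w : m.-tuple T | [forall i, P i (tnth w i)]]| = \prod_(i < m) #|P i|.
Proof.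
pose f (g : {ffun 'I_m -> T}) := [tuple g i | i < m].
have fK : cancel f (fun w => [ffun i => tnth w i]).
  by move=> g; apply/ffunP => i; rewrite ffunE tnth_mktuple.
have Kf : cancel (fun w : m.-tuple T => [ffun i => tnth w i]) f.
  by move=> w; apply: eq_from_tnth => i; rewrite tnth_mktuple ffunE.
rewrite -(on_card_preimset (f := f)); last first.
  by apply: onW_bij; exists (fun w => [ffun i => tnth w i]).
transitivity #|family P|.
  apply: eq_card => g; rewrite !inE; apply: eq_forallb => i.
  by rewrite tnth_mktuple.
by rewrite card_family foldrE big_map big_enum.
Qed.

Lemma card_tuple_all (T : finType) m (P : pred T) :
  #|[set w : m.-tuple T | all P w]| = #|P| ^ m.
Proof.
transitivity #|[set w : m.-tuple T | [forall i, P (tnth w i)]]|.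
  by apply: eq_card => w; rewrite !inE; apply/all_tnthP/forallP.
by rewrite (card_tuple_forall (fun=> P)) prod_nat_const card_ord.
Qed.

(** Preimages of the entries are chosen independently, [r] for each. This transfers counts between
    lists of clauses and lists of triples. *)
Lemma card_tuple_fibers (T T' : finType) m r (g : T -> T') (A : {set T})
    (B : {set T'}) (P : pred (m.-tuple T')) :
  {in A, forall t, g t \in B} ->
  {in B, forall c, #|[set t in A | g t == c]| = r} ->
  #|[set w : m.-tuple T | all [in A] w & P (map_tuple g w)]| =
  (#|[set w : m.-tuple T' | all [in B] w & P w]| * r ^ m)%N.
Proof.
move=> gA gB; rewrite -sum1_card.
rewrite (partition_big (map_tuple g)
  [in [set w : m.-tuple T' | all [in B] w & P w]]) /=; last first.
  move=> w; rewrite !inE => /andP[/allP wA ->]; rewrite andbT.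
  by apply/allP => _ /mapP[t tw ->]; apply: gA; apply: wA.
rewrite -sum_nat_const; apply: eq_bigr => w; rewrite inE => /andP[/all_tnthP wB Pw].
rewrite sum1_card -[RHS]muln1.
transitivity #|[set v : m.-tuple T |
    [forall i, [pred t | (t \in A) && (g t == tnth w i)] (tnth v i)]]|.
  apply: eq_card => v; rewrite !inE unfold_in inE; apply/idP/forallP => [|h].
    case/andP => /andP[/all_tnthP vA _] /eqP <- i.
    by rewrite inE tnth_map eqxx andbT; apply: vA.
  have -> : map_tuple g v = w.
    apply: eq_from_tnth => i; rewrite tnth_map.
    by have /andP[_ /eqP] := h i.
  by rewrite Pw eqxx !andbT; apply/all_tnthP => i; have /andP[] := h i.
rewrite (card_tuple_forall (fun i => [pred t | (t \in A) && (g t == tnth w i)])).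
rewrite muln1 -[in RHS](card_ord m) -prod_nat_const.
by apply: eq_bigr => i _; rewrite -(gB _ (wB i)); apply: eq_card => t; rewrite !inE.
Qed.

Section Clauses.

Variable n : nat.
Local Notation V := 'I_n.+1.
Local Notation triple := (V * V * V)%type.
Implicit Types (K X : {set V}) (t : triple).

Definition clause_of t : clause n.+1 :=
  [set (t.1.1, false); (t.1.2, false); (t.2, true)].

Definition distinct3 : {set triple} :=
  [set t | uniq [:: t.1.1; t.1.2; t.2]].

Lemma clause_of_horn3 t : t \in distinct3 -> clause_of t \in horn3 n.+1.
Proof.
case: t => -[a b] c; rewrite !inE /= !inE negb_or andbT => /andP[/andP[ab ac] bc].
have -> : #|clause_of (a, b, c)| = 3.
  rewrite /clause_of -setUA cardsU1 cards2 !inE /= !xpair_eqE /= !andbT !andbF !orbF.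
  by rewrite (negPf ab).
rewrite eqxx /=.
have -> : clause_vars (clause_of (a, b, c)) = [set a; b; c].
  by rewrite /clause_vars /clause_of !imsetU !imset_set1.
rewrite -setUA cardsU1 cards2 !inE (negPf ab) (negPf ac) bc /=.
apply/cards1P; exists (c, true); apply/setP => -[x []]; rewrite !inE /= !xpair_eqE.
  by rewrite !andbF /= !andbT.
by rewrite !andbF.
Qed.

Lemma horn3_clause_of (c : clause n.+1) :
  c \in horn3 n.+1 -> exists2 t, t \in distinct3 & clause_of t = c.
Proof.
rewrite inE => /and3P[/eqP c3 /eqP v3 /cards1P[[h b] chb]].
have /setIdP[hc /= bT] : (h, b) \in positive_part c by rewrite chb set11.
rewrite {b}bT in chb hc.
have inj : {in c &, injective (@fst V bool)}.
  by apply/imset_injP; rewrite -/(clause_vars c) v3 c3.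
have neg l : l \in c :\ (h, true) -> l.2 = false.
  case: l => l []; rewrite inE => /andP[ne lc] //=.
  have : (l, true) \in positive_part c by rewrite inE lc.
  by rewrite chb (negPf ne).
have /cards2P[[x x2] [[y y2] [xy cxy]]] : #|c :\ (h, true)| == 2.
  by have := cardsD1 (h, true) c; rewrite hc c3 add1n => -[<-].
have x2F : x2 = false by apply: (neg (x, x2)); rewrite cxy !inE eqxx.
have y2F : y2 = false by apply: (neg (y, y2)); rewrite cxy !inE eqxx orbT.
rewrite {x2}x2F {y2}y2F in xy cxy.
have ec : clause_of (x, y, h) = c.
  by rewrite /clause_of /= -cxy setUC setD1K.
have [xc yc] : (x, false) \in c /\ (y, false) \in c.
  by rewrite -ec !inE !eqxx ?orbT.
exists (x, y, h) => //; rewrite inE /= !inE andbT negb_or -andbA.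
apply/and3P; split.
- by apply: contraNneq xy => ->.
- by apply/eqP => xh; have := inj _ _ xc hc xh.
- by apply/eqP => yh; have := inj _ _ yc hc yh.
Qed.

(* Exchanging the two variables of the body gives the same clause. *)
Lemma card_clause_of_fiber (c : clause n.+1) :
  c \in horn3 n.+1 -> #|[set t in distinct3 | clause_of t == c]| = 2.
Proof.
move=> /horn3_clause_of[[[x y] h] td <-] {c}.
have xy : x != y by move: td; rewrite !inE /= !inE negb_or => /andP[/andP[]].
suff -> : [set t in distinct3 | clause_of t == clause_of (x, y, h)] =
    [set (x, y, h); (y, x, h)].
  by rewrite cards2 !xpair_eqE (negPf xy).
apply/setP => t; rewrite in_set2 inE; apply/andP/idP; last first.
  case/orP => /eqP ->; split=> //; last by rewrite /clause_of /= (setUC [set (y, false)]).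
  by move: td; rewrite !inE /= !inE !negb_or !andbT (eq_sym y x) -!andbA => /and3P[-> -> ->].
case: t => -[a b] c; rewrite inE /= !inE negb_or andbT.
case=> /andP[/andP[ab ac] bc] /eqP/setP e.
move: (e (c, true)) (e (a, false)) (e (b, false)).
rewrite !inE /= !xpair_eqE /= !andbF !andbT !eqxx /= !orbF !orbT.
move=> /esym/eqP-> /esym/orP ea /esym/orP eb; move: ab.
by case: ea => /eqP->; case: eb => /eqP->; rewrite ?eqxx // orbT.
Qed.

Lemma card_distinct3 : #|distinct3| = (n.+1 ^_ 3)%N.
Proof.
rewrite -bin_ffact -sum1_card (partition_big clause_of [in horn3 n.+1]) /=.
  rewrite (eq_bigr (fun=> 2)) => [|c c3]; last first.
    rewrite sum1_card; apply: etrans (card_clause_of_fiber c3).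
    by apply: eq_card => t; rewrite !inE unfold_in !inE.
  by rewrite sum_nat_const card_horn3 mulnC mulnA mulnC.
exact: clause_of_horn3.
Qed.

(** The positive unit clauses and the clauses of length 3 ask for the set of true variables to be
    closed, the negative unit clause for it to miss [ord0]. Such a set exists exactly when [ord0] is
    outside the intersection of all closed sets. *)
Lemma satisfiableE m K (w : m.-tuple triple) :
  satisfiable (horn_formula (K, map_tuple clause_of w)) =
  (ord0 \notin horn_closure K w).
Proof.
have holds2 s t : clause_holds s (clause_of t) = (s t.1.1 && s t.1.2 ==> s t.2).
  apply/exists_inP/idP => [[l + /eqP sl]|].
    by rewrite /clause_of !inE -orbA => /or3P[] /eqP le; rewrite le /= in sl;
       rewrite sl ?andbF ?implybT.
  move=> h; have [s1|s1] := boolP (s t.1.1); last first.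
    by exists (t.1.1, false); rewrite ?inE ?eqxx //= (negPf s1).
  have [s2|s2] := boolP (s t.1.2); last first.
    by exists (t.1.2, false); rewrite ?inE ?eqxx ?orbT //= (negPf s2).
  exists (t.2, true); rewrite ?inE ?eqxx ?orbT //=.
  by rewrite s1 s2 /= in h; rewrite h.
have holds1 (s : {ffun V -> bool}) l : clause_holds s [set l] = (s l.1 == l.2).
  apply/exists_inP/idP => [[l']|]; first by rewrite inE => /eqP->.
  by exists l; rewrite ?inE.
rewrite inE negb_forall; apply/existsP/existsP => [[s]|[X]].
  rewrite /= all_cat !all_map holds1 /= => /and3P[/eqP s0 /allP sK /allP sw].
  exists [set v | s v]; rewrite negb_imply inE s0 andbT; apply/andP; split.
    apply/subsetP => v vK; rewrite inE; have := sK v.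
    by rewrite mem_enum => /(_ vK) /=; rewrite holds1 /= => /eqP.
  by apply/allP => t /sw; rewrite /= holds2 !inE.
rewrite negb_imply => /andP[/andP[/subsetP KX /allP wX] X0].
exists [ffun v => v \in X]; rewrite /= all_cat !all_map holds1 /= ffunE (negPf X0) /=.
apply/andP; split; apply/allP => x /=.
  by rewrite mem_enum holds1 /= ffunE => /KX ->.
by move=> /wX; rewrite holds2 !ffunE.
Qed.

(** * Symmetry between the variables outside [K] *)

Definition permute_triple (p : {perm V}) t : triple := (p t.1.1, p t.1.2, p t.2).

(** Swapping two variables outside [K] fixes [K] pointwise, so it carries closed sets for one list
    of triples to closed sets for the other. *)
Lemma horn_closure_tperm K (w : seq triple) u v : u \notin K -> v \notin K ->
  u \in horn_closure K w ->
  v \in horn_closure K (map (permute_triple (tperm u v)) w).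
Proof.
move=> uK vK; rewrite !inE => /forallP uC; apply/forallP => X.
apply/implyP => /andP[/subsetP KX /allP wX].
have /implyP := uC [set x | tperm u v x \in X]; rewrite inE tpermL; apply.
apply/andP; split.
  apply/subsetP => x xK; rewrite inE tpermD ?KX//.
    by apply: contraNneq uK => ->.
  by apply: contraNneq vK => ->.
by apply/allP => t tw; rewrite !inE; apply: (wX _ (map_f _ tw)).
Qed.

Lemma card_closure_sym m K u v : u \notin K -> v \notin K ->
  #|[set w : m.-tuple triple | all [in distinct3] w & u \in horn_closure K w]| <=
  #|[set w : m.-tuple triple | all [in distinct3] w & v \in horn_closure K w]|.
Proof.
move=> uK vK.
pose f := permute_triple (tperm u v).
have fI : injective (map_tuple f : m.-tuple triple -> m.-tuple triple).
  apply: (@can_inj _ _ _ (map_tuple f)) => w; apply: eq_from_tnth => i.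
  by rewrite !tnth_map /f /permute_triple /= !tpermK; case: (tnth w i) => -[].
rewrite -(card_imset _ fI); apply: subset_leq_card.
apply/subsetP => _ /imsetP[w + ->].
rewrite [w \in _]inE inE /= => /andP[wd uw].
rewrite [_ \in horn_closure _ _](horn_closure_tperm uK vK uw) andbT all_map; apply: sub_all wd => -[[a b] c] /=.
by rewrite /f /permute_triple !inE /= !inE !(inj_eq perm_inj).
Qed.

(** Pairs of a list and an underived variable are counted in two ways; by symmetry each variable
    outside [K] is underived as often as [ord0]. This reduces satisfiability to the size of the
    closure. *)
Lemma card_sat_double_count m K : ord0 \notin K ->
  (#|[set w : m.-tuple triple |
       all [in distinct3] w & ord0 \notin horn_closure K w]| * #|~: K|)%N =
  (\sum_(w : m.-tuple triple | all [in distinct3] w) #|~: horn_closure K w|)%N.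
Proof.
move=> K0; transitivity (\sum_(v in ~: K) #|[set w : m.-tuple triple |
    all [in distinct3] w & v \notin horn_closure K w]|)%N.
  rewrite mulnC -sum_nat_const; apply: eq_bigr => v; rewrite inE => vK.
  have e x : #|[set w : m.-tuple triple |
        all [in distinct3] w & x \notin horn_closure K w]| =
      (#|[set w : m.-tuple triple | all [in distinct3] w]| -
       #|[set w : m.-tuple triple |
          all [in distinct3] w & x \in horn_closure K w]|)%N.
    rewrite -cardsDS; last by apply/subsetP => w; rewrite !inE => /andP[].
    by apply: eq_card => w; rewrite !inE; case: (all _ w); rewrite /= ?andbT ?andbF.
  by rewrite !e; congr (_ - _)%N; apply/eqP; rewrite eqn_leq !card_closure_sym.
under eq_bigr do rewrite -sum1_card.
under [RHS]eq_bigr do rewrite -sum1_card.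
rewrite (exchange_big_dep (fun w : m.-tuple triple => all [in distinct3] w)) /=.
  apply: eq_bigr => w wd; apply: eq_bigl => v; rewrite !inE wd.
  apply/idP/idP => [/and3P[]//|vC]; rewrite vC !andbT; apply: contra vC => vK.
  by apply/forallP => X; apply/implyP => /andP[/subsetP/(_ _ vK)].
by move=> v w _; rewrite inE => /andP[].
Qed.

(** Relabelling is an injective self-map of a finite set, hence a bijection preserving the uniform
    distribution: the closure may be studied on triples of times. *)
Lemma card_closure_relabel m K (P : pred {set V}) :
  #|[set w : m.-tuple triple | P (horn_closure K w)]| =
  #|[set w : m.-tuple triple |
      P (horn_closure K (map (relabel_triple K w) w))]|.
Proof.
have fI : injective (fun w : m.-tuple triple => map_tuple (relabel_triple K w) w).
  by move=> w1 w2 /(congr1 val) /relabel_inj /val_inj.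
rewrite -(on_card_preimset (onW_bij _ (injF_bij fI))).
by apply: eq_card => w; rewrite !inE.
Qed.

End Clauses.

(** * Concentration of the number of unfired variables *)

Section Moments.

Variable n : nat.
Local Notation V := 'I_n.+1.
Local Notation triple := (V * V * V)%type.
Implicit Types (K A : {set V}) (t : triple).

Lemma card_unfired A s : s <= n.+1 ->
  #|[pred t : triple | ~~ [&& t.1.1 < s, t.1.2 < s & t.2 \in A]]| =
  (n.+1 ^ 3 - s ^ 2 * #|A|)%N.
Proof.
move=> sn; pose S := [set i : V | i < s].
have cS : #|S| = s.
  have wI : injective (widen_ord sn) by move=> i j [/val_inj].
  rewrite -[RHS]card_ord -[RHS](card_imset 'I_s wI).
  apply: eq_card => i; rewrite inE; apply/idP/imsetP => [is_|[j _ ->]] /=.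
    by exists (Ordinal is_) => //; apply: val_inj.
  exact: ltn_ord.
have := cardC [in setX (setX S S) A]; rewrite !cardsX cS !card_prod !card_ord.
have -> : (s * s * #|A|)%N = (s ^ 2 * #|A|)%N by rewrite -mulnn.
have -> : (n.+1 * n.+1 * n.+1)%N = (n.+1 ^ 3)%N by rewrite !expnS expn0 muln1 mulnA.
move=> <-; rewrite addKn; apply: eq_card => t.
by rewrite !inE -andbA.
Qed.

Lemma card_disjoint_fired m K A s : s <= n.+1 -> [disjoint A & K] ->
  #|[set w : m.-tuple triple | [disjoint A & fired K w s]]| =
  ((n.+1 ^ 3 - s ^ 2 * #|A|) ^ m)%N.
Proof.
move=> sn AK; rewrite -card_unfired// -card_tuple_all.
apply: eq_card => w; rewrite !inE; apply/pred0P/allP => [h t tw|h v].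
  apply/negP => /and3P[t1 t2 tA]; have := h t.2; rewrite /= tA !inE.
  by move/negbT; rewrite negb_or => /andP[_ /hasPn/(_ t tw)]; rewrite t1 t2 eqxx.
apply/negP => /= /andP[vA]; rewrite !inE => /orP[vK|].
  by have /pred0P/(_ v) := AK; rewrite /= vA vK.
by case/hasP => t tw /and3P[t1 t2 /eqP tv]; have := h t tw; rewrite /= t1 t2 tv vA.
Qed.

Lemma sum_card_unfired m K s : s <= n.+1 ->
  \sum_(w : m.-tuple triple) #|~: fired K w s| =
  (#|~: K| * (n.+1 ^ 3 - s ^ 2) ^ m)%N.
Proof.
move=> sn; transitivity (\sum_(v in ~: K)
    #|[set w : m.-tuple triple | [disjoint [set v] & fired K w s]]|)%N.
  transitivity (\sum_(w : m.-tuple triple) \sum_(v in ~: fired K w s) 1)%N.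
    by apply: eq_bigr => w _; rewrite sum1_card.
  rewrite (exchange_big_dep [in ~: K]) /=; last first.
    by move=> w v _; rewrite !inE negb_or => /andP[].
  apply: eq_bigr => v vK; rewrite -sum1_card; apply: eq_bigl => w.
  by rewrite in_setC [RHS]inE disjoints1.
rewrite -sum_nat_const; apply: eq_bigr => v; rewrite inE => vK.
by rewrite card_disjoint_fired ?disjoints1// cards1 muln1.
Qed.

(** Pairs of equal variables give the first term, pairs of distinct ones the second; a pair has two
    forbidden heads, whence [s ^ 2 * 2]. *)
Lemma sum_card_unfired_sqr m K s : s <= n.+1 ->
  \sum_(w : m.-tuple triple) #|~: fired K w s| ^ 2 =
  (#|~: K| * ((n.+1 ^ 3 - s ^ 2) ^ m +
              (#|~: K|.-1) * (n.+1 ^ 3 - s ^ 2 * 2) ^ m))%N.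
Proof.
move=> sn; transitivity (\sum_(v in ~: K) \sum_(v' in ~: K)
    #|[set w : m.-tuple triple | [disjoint [set v; v'] & fired K w s]]|)%N.
  transitivity (\sum_(w : m.-tuple triple) \sum_(v in ~: fired K w s)
     \sum_(v' in ~: fired K w s) 1)%N.
    by apply: eq_bigr => w _; rewrite sum1_card sum_nat_const -mulnn.
  rewrite (exchange_big_dep [in ~: K]) /=; last first.
    by move=> w v _; rewrite !inE negb_or => /andP[].
  apply: eq_bigr => v vK; rewrite (exchange_big_dep [in ~: K]) /=; last first.
    by move=> w v' _; rewrite !inE negb_or => /andP[].
  apply: eq_bigr => v' v'K; rewrite -sum1_card; apply: eq_bigl => w.
  by rewrite [RHS]inE disjoints_subset subUset !sub1set.
rewrite -sum_nat_const; apply: eq_bigr => v vK.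
rewrite (bigD1 v)//= setUid card_disjoint_fired ?disjoints1 -?in_setC//.
rewrite cards1 muln1; congr (_ + _)%N.
rewrite (cardsD1 v (~: K)) vK /= -sum_nat_const.
apply: eq_big => [v'|v' /andP[v'K v'v]]; first by rewrite in_setD1 andbC.
rewrite card_disjoint_fired//; first by rewrite cards2 eq_sym v'v.
by rewrite disjoints_subset subUset !sub1set vK.
Qed.

End Moments.

(* Imported only now because classical_sets shadows many names of finset. *)
From HB Require Import structures.
From mathcomp Require Import all_boot all_order all_algebra.
From mathcomp Require Import all_classical all_reals all_analysis.
From mathcomp Require Import ring lra.
Import Order.TTheory GRing.Theory Num.Theory.
Import numFieldNormedType.Exports.
Local Open Scope classical_set_scope.
Local Open Scope ring_scope.

Section Concentration.

Variables (R : realType) (n : nat).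
Local Notation V := 'I_n.+1.
Local Notation triple := (V * V * V)%type.
Implicit Types (K : {set V}).

(** Probability that a given variable outside [K] is the head of none of [m] uniform triples with
    both times below [s]: of the [n.+1 ^+ 3] values of a triple, [s ^+ 2] are forbidden. *)
Definition miss_prob (s m : nat) : R :=
  (1 - s%:R ^+ 2 / n.+1%:R ^+ 3) ^+ m.

(** Distinct variables stay unfired with nonpositive correlation, because
    [1 - 2 * x <= (1 - x) ^+ 2]. Hence the variance is at most the mean, which is at most
    [#|~: K|]. *)
Lemma variance_unfired m K s : (s <= n.+1)%N ->
  \sum_(w : m.-tuple triple)
     (#|~: fired K w s|%:R - #|~: K|%:R * miss_prob s m) ^+ 2
  <= #|~: K|%:R * #|{: m.-tuple triple}|%:R.
Proof.
move=> sn; set k := #|~: K|; set N : R := n.+1%:R.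
have N0 : 0 < N by rewrite ltr0n.
have N1 : 1 <= N by rewrite ler1n.
have sN : (s%:R : R) <= N by rewrite ler_nat.
have sN2 : (s ^ 2 <= n.+1 ^ 3)%N.
  by rewrite (leq_trans (_ : _ <= n.+1 ^ 2)%N) ?leq_exp2r// leq_pexp2l.
set M := #|{: m.-tuple triple}|%:R.
have ME : M = (N ^+ 3) ^+ m.
  by rewrite /M card_tuple !card_prod !card_ord natrX !natrM -/N; congr (_ ^+ _); ring.
have M0 : 0 < M by rewrite ME !exprn_gt0.
have N30 : 0 <= N ^+ 3 by rewrite exprn_ge0 // ltW.
pose x : R := s%:R ^+ 2 / N ^+ 3.
have x0 : 0 <= x by rewrite divr_ge0 ?exprn_ge0 ?ler0n// ltW.
have x1 : x <= 1.
  rewrite ler_pdivrMr ?exprn_gt0// mul1r.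
  have : (s ^ 2)%:R <= (n.+1 ^ 3)%:R :> R by rewrite ler_nat.
  by rewrite !natrX.
set q := miss_prob s m; have qE : q = (1 - x) ^+ m by [].
have q0 : 0 <= q by rewrite qE exprn_ge0// subr_ge0.
have q1 : q <= 1 by rewrite qE exprn_ile1// ?subr_ge0// lerBlDr lerDl.
have S1 : \sum_(w : m.-tuple triple) #|~: fired K w s|%:R = k%:R * (M * q).
  rewrite -natr_sum sum_card_unfired// natrM natrX natrB// !natrX -/N; congr (_ * _).
  by rewrite ME qE -exprMn /x mulrBr mulr1 mulrCA divff ?mulr1// lt0r_neq0 ?exprn_gt0.
have S2 : \sum_(w : m.-tuple triple) (#|~: fired K w s|%:R) ^+ 2
    <= k%:R * (M * q + k%:R * (M * q ^+ 2)) :> R.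
  under eq_bigr do rewrite -natrX.
  rewrite -natr_sum sum_card_unfired_sqr// natrM natrD natrX natrB// !natrX -/N -/k.
  have -> : (N ^+ 3 - s%:R ^+ 2) ^+ m = M * q.
    by rewrite ME qE -exprMn /x mulrBr mulr1 mulrCA divff ?mulr1// lt0r_neq0 ?exprn_gt0.
  apply: ler_wpM2l; first exact: ler0n.
  apply: lerD => //; rewrite natrM; apply: ler_pM; rewrite ?ler0n// ?ler_nat ?leq_pred//.
  rewrite ME qE (_ : _ * _ = (N ^+ 3 * (1 - x) ^+ 2) ^+ m); last first.
    by rewrite [RHS]exprMn; congr (_ * _); rewrite -!exprM mulnC.
  rewrite natrX; apply: lerXn2r.
  - by rewrite nnegrE ler0n.
  - by rewrite nnegrE mulr_ge0 ?sqr_ge0.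
  (* Subtraction of naturals truncates to [0] when [s ^ 2 * 2] exceeds [n.+1 ^ 3], so that case is
     separate. *)
  have [le2|/ltnW le2] := leqP (s ^ 2 * 2)%N (n.+1 ^ 3)%N; last first.
    move: (le2); rewrite -subn_eq0 => /eqP->.
    by rewrite mulr_ge0 ?sqr_ge0.
  rewrite natrB// natrM !natrX -/N.
  have -> : s%:R ^+ 2 = N ^+ 3 * x by rewrite /x mulrCA divff ?mulr1// lt0r_neq0 ?exprn_gt0.
  rewrite -mulrA -[X in X - _]mulr1 -mulrBr; apply: ler_wpM2l => //.
  nra.
have -> : \sum_(w : m.-tuple triple) (#|~: fired K w s|%:R - k%:R * q) ^+ 2 =
   \sum_(w : m.-tuple triple) (#|~: fired K w s|%:R) ^+ 2
   - 2 * (k%:R * q) * (k%:R * (M * q)) + M * (k%:R * q) ^+ 2.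
  rewrite -S1 /M -sum1_card natr_sum mulr_sumr mulr_suml -sumrB -big_split /=.
  by apply: eq_bigr => w _; ring.
have : k%:R * M * (1 - q) >= 0 by rewrite !mulr_ge0 ?ler0n// ?subr_ge0// ltW.
move: S2; set S := \sum_(_ : m.-tuple triple) _; lra.
Qed.

(** Since the variance is at most [n.+1], the fraction of lists with a deviation of order [n.+1] is
    of order [1 / n.+1]. *)
Lemma chebyshev_unfired m K s (d : R) : (s <= n.+1)%N -> 0 < d ->
  #|[set w : m.-tuple triple | d * n.+1%:R <=
      `|#|~: fired K w s|%:R - #|~: K|%:R * miss_prob s m| ]%SET|%:R
    * (d ^+ 2 * n.+1%:R)
  <= #|{: m.-tuple triple}|%:R :> R.
Proof.
move=> sn d0; set B := finset _; set N : R := n.+1%:R; set M := (X in _ <= X).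
have N0 : 0 < N by rewrite ltr0n.
have KN : #|~: K|%:R <= N by rewrite ler_nat -[leqRHS]card_ord max_card.
have M0 : 0 <= M by rewrite ler0n.
rewrite -(ler_pM2r N0); apply: le_trans (_ : #|~: K|%:R * M <= _); last first.
  by rewrite mulrC ler_wpM2l.
apply: le_trans (variance_unfired m K sn).
rewrite (bigID [in B]) /= -[leLHS]addr0; apply: lerD; last first.
  by apply: sumr_ge0 => w _; apply: sqr_ge0.
have -> : #|B|%:R * (d ^+ 2 * N) * N = \sum_(w in B) (d * N) ^+ 2.
  by rewrite sumr_const -mulr_natl; ring.
apply: ler_sum => w; rewrite inE => h.
rewrite -[leRHS]real_normK ?num_real//; apply: lerXn2r => //; rewrite nnegrE ?normr_ge0//.
by rewrite mulr_ge0// ltW.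
Qed.

End Concentration.

(** * Limits of the rounded quantities *)

Lemma cvg_truncn_div (R : realType) (t : R) : 0 <= t ->
  (Num.truncn (t * n.+1%:R))%:R / n.+1%:R @[n --> \oo] --> t.
Proof.
move=> t0; apply: (@squeeze_cvgr _ _ _ _ (fun n => t - harmonic n) (fun=> t)).
- apply: nearW => n; have N0 : 0 < n.+1%:R :> R by rewrite ltr0n.
  have /andP[le1 lt1] := truncn_itv (mulr_ge0 t0 (ltW N0)).
  rewrite ler_pdivrMr// le1 andbT ler_pdivlMr// mulrBl /harmonic mulVf ?gt_eqF//.
  by rewrite lerBlDr natr1 ltW.
- rewrite -[X in _ --> X]subr0; apply: cvgB; first exact: cvg_cst.
  exact: cvg_harmonic.
- exact: cvg_cst.
Qed.

(** Squeezed between [1 - x <= expR (- x)] and [expR (- (x / (1 - x))) <= 1 - x]; the latter is the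
    inverse of [1 + y <= expR y] at [y = x / (1 - x)]. *)
Lemma cvg_expr_exp (R : realType) (x : R^nat) (m : nat -> nat) (c : R) :
  (forall n, 0 <= x n) -> x @ \oo --> 0 -> (m n)%:R * x n @[n --> \oo] --> c ->
  (1 - x n) ^+ m n @[n --> \oo] --> expR (- c).
Proof.
move=> x0 xl ml.
apply: (@squeeze_cvgr _ _ _ _ (fun n => expR (- ((m n)%:R * x n / (1 - x n))))
          (fun n => expR (- ((m n)%:R * x n)))).
- near=> n.
  have x1 : x n < 1 by near: n; apply: (cvgr_lt 0).
  have y0 : 0 < 1 - x n by rewrite subr_gt0.
  apply/andP; split.
    rewrite -mulrA -mulrN expRM_natl lerXn2r ?nnegrE ?expR_ge0 ?(ltW y0)//.
    rewrite expRN -[leRHS]invrK lef_pV2 ?posrE ?invr_gt0 ?expR_gt0//.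
    apply: le_trans (expR_ge1Dx _); rewrite le_eqVlt; apply/orP; left; apply/eqP.
    by field; rewrite gt_eqF.
  rewrite -mulrN expRM_natl lerXn2r ?nnegrE ?expR_ge0 ?(ltW y0)//.
  exact: expR_ge1Dx.
- apply: (@continuous_cvg _ _ _ _ _ _ expR); first exact: continuous_expR.
  apply: cvgN; rewrite -[c]divr1; apply: cvgM => //; apply: cvgV => //.
  by rewrite -[X in _ --> X]subr0; apply: cvgB => //; apply: cvg_cst.
- by apply: (@continuous_cvg _ _ _ _ _ _ expR);
    [exact: continuous_expR|exact: cvgN].
Unshelve. all: by end_near. Qed.

Lemma cvg_miss_prob (R : realType) (d t : R) : 0 <= d -> 0 <= t ->
  miss_prob R n (Num.truncn (t * n.+1%:R)) (Num.truncn (d * n.+1%:R))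
    @[n --> \oo] --> expR (- (d * t ^+ 2)).
Proof.
move=> d0 t0; apply: cvg_expr_exp => [n||].
- by rewrite divr_ge0 ?exprn_ge0 ?ler0n.
- have -> : (fun n => (Num.truncn (t * n.+1%:R))%:R ^+ 2 / n.+1%:R ^+ 3 : R) =
      (fun n => ((Num.truncn (t * n.+1%:R))%:R / n.+1%:R) ^+ 2 * harmonic n).
    apply/funext => n; rewrite /harmonic /=; have : n.+1%:R != 0 :> R by [].
    by set N : R := n.+1%:R; move: N (Num.truncn _) => N y N0; field.
  rewrite -[X in _ --> X](mulr0 (t ^+ 2)); apply: cvgM; last exact: cvg_harmonic.
  by rewrite expr2; under eq_fun do rewrite expr2; apply: cvgM; exact: cvg_truncn_div.
- have -> : (fun n => (Num.truncn (d * n.+1%:R))%:R *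
      ((Num.truncn (t * n.+1%:R))%:R ^+ 2 / n.+1%:R ^+ 3) : R) =
    (fun n => ((Num.truncn (d * n.+1%:R))%:R / n.+1%:R) *
      (((Num.truncn (t * n.+1%:R))%:R / n.+1%:R) *
       ((Num.truncn (t * n.+1%:R))%:R / n.+1%:R))).
    apply/funext => n; have : n.+1%:R != 0 :> R by [].
    set N : R := n.+1%:R; move: N (Num.truncn (t * _)) (Num.truncn (d * _)).
    by move=> N y z N0; field.
  rewrite expr2; apply: cvgM; first exact: cvg_truncn_div.
  by apply: cvgM; exact: cvg_truncn_div.
Qed.

Section Asymptotics.

Variables (R : realType) (d1 d3 : R).
Hypotheses (d1_ge0 : 0 <= d1) (d1_lt1 : d1 < 1) (d3_ge0 : 0 <= d3).

Local Notation N n := (n.+1%:R : R).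
Local Notation k n := (Num.truncn (d1 * N n)).
Local Notation m n := (Num.truncn (d3 * N n)).
Local Notation triple n := ('I_n.+1 * 'I_n.+1 * 'I_n.+1)%type.

(** Limiting fraction of the variables that are still unfired at time [t * N n]. *)
Definition miss (t : R) : R := (1 - d1) * expR (- (d3 * t ^+ 2)).

Lemma truncn_mul_leq (t : R) n : 0 <= t <= 1 -> (Num.truncn (t * N n) <= n.+1)%N.
Proof.
move=> /andP[t0 t1]; rewrite -(ler_nat R); apply: le_trans (_ : t * N n <= _).
  by have /andP[] := truncn_itv (mulr_ge0 t0 (ler0n R n.+1)).
by rewrite ler_piMl.
Qed.

Lemma truncn_mul_lt n : (k n < n.+1)%N.
Proof.
rewrite -(ltr_nat R); apply: le_lt_trans (_ : d1 * N n < _).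
  by have /andP[] := truncn_itv (mulr_ge0 d1_ge0 (ler0n R n.+1)).
by rewrite gtr_pMl.
Qed.

(** The bounds depend on [K] only through its size, so one threshold for [n] serves all [K]. *)
Lemma unfired_concentration (t d e : R) : 0 <= t <= 1 -> 0 < d -> 0 < e ->
  \forall n \near \oo, forall K : {set 'I_n.+1}, #|K| = k n ->
  #|[set w : (m n).-tuple (triple n) | d * N n <=
      `|#|~: fired K w (Num.truncn (t * N n))|%:R - miss t * N n| ]%SET|%:R
  <= e * #|{: (m n).-tuple (triple n)}|%:R.
Proof.
move=> t01 d0 e0; have t0 : 0 <= t by case/andP: t01.
pose q n := miss_prob R n (Num.truncn (t * n.+1%:R)) (m n).
have ql : (1 - (k n)%:R / N n) * q n @[n --> \oo] --> miss t.
  apply: cvgM; last exact: cvg_miss_prob.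
  by apply: cvgB; [exact: cvg_cst|exact: cvg_truncn_div].
(* Half of the tolerance [d] pays for Chebyshev, half for replacing the mean by its limit. *)
have d20 : 0 < d / 2 by rewrite divr_gt0.
near=> n => K Kk.
have N0 : 0 < N n by rewrite ltr0n.
have qn : `|miss t - (1 - (k n)%:R / N n) * q n| < d / 2.
  by near: n; move/cvgrPdist_lt : ql => /(_ _ d20).
have cK : #|~: K|%:R = (1 - (k n)%:R / N n) * N n.
  have : (k n + #|~: K|)%:R = N n by rewrite -Kk cardsC card_ord.
  by rewrite natrD => E; rewrite mulrBl mul1r divfK ?gt_eqF//; lra.
have := chebyshev_unfired (m n) K (truncn_mul_leq n t01) d20; rewrite -/(q n).
set A := finset _; set B := finset _; set M := (X in _ <= X) => AM.
have BA : B \subset A.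
  apply/fintype.subsetP => w; rewrite !inE => h.
  have : `|(#|~: K|%:R * q n) - miss t * N n| <= d / 2 * N n.
    rewrite cK mulrAC -mulrBl normrM distrC (gtr0_norm N0) ler_wpM2r ?ltW//.
  move: h; set y := (#|_|%:R); set z := _ * q n => h h'.
  have := ler_distD z y (miss t * N n); lra.
have : #|B|%:R <= #|A|%:R :> R by rewrite ler_nat subset_leq_card.
move/le_trans; apply.
have M0 : 0 <= M by rewrite ler0n.
have D0 : 0 < (d / 2) ^+ 2 * N n by rewrite mulr_gt0// exprn_gt0.
rewrite -(ler_pM2r D0); apply: le_trans AM _.
rewrite mulrAC ler_peMl// mulrA.
have : harmonic n < e * (d / 2) ^+ 2.
  near: n; apply: (cvgr_lt 0); first exact: cvg_harmonic.
  by rewrite mulr_gt0// exprn_gt0.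
by rewrite /harmonic /= -(ltr_pM2r N0) mulVf ?gt_eqF// => /ltW.
Unshelve. all: by end_near. Qed.

End Asymptotics.

(** * Size of the closure *)

Lemma leq_card_bigcup (T : finType) L (B : 'I_L -> {set T}) :
  (#|\bigcup_(i < L) B i| <= \sum_(i < L) #|B i|)%SET%N.
Proof.
elim/big_rec2: _ => [|i n A _ le]; first by rewrite cards0.
by apply: leq_trans (leq_card_setU _ _) _; rewrite leq_add2l.
Qed.

Lemma nat_bracket (s : nat -> nat) L j : (s 0 <= j)%N -> (j < s L)%N ->
  exists2 i, (i < L)%N & (s i <= j < s i.+1)%N.
Proof.
elim: L => [|L IHL] s0 sL; first by rewrite ltnNge s0 in sL.
have [sj|js] := leqP (s L) j; first by exists L; rewrite ?sj.
by have [i iL ?] := IHL s0 js; exists i => //; apply: ltnW.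
Qed.

Section ClosureSize.

Variables (R : realType) (d1 d3 : R).
Hypotheses (d1_ge0 : 0 <= d1) (d1_lt1 : d1 < 1) (d3_ge0 : 0 <= d3).

Local Notation N n := (n.+1%:R : R).
Local Notation k n := (Num.truncn (d1 * N n)).
Local Notation m n := (Num.truncn (d3 * N n)).
Local Notation triple n := ('I_n.+1 * 'I_n.+1 * 'I_n.+1)%type.
Local Notation miss := (miss d1 d3).

Lemma near_large (d : R) : 0 < d -> \forall n \near \oo, 1 <= d * N n.
Proof.
move=> d0; near=> n; have N0 : 0 < N n by rewrite ltr0n.
have : harmonic n < d by near: n; apply: (cvgr_lt 0) => //; exact: cvg_harmonic.
by rewrite /harmonic /= -(ltr_pM2r N0) mulVf ?gt_eqF// => /ltW.
Unshelve. all: by end_near. Qed.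

(** A single time is enough: at [b * N n] the limiting fired fraction [1 - miss b] is below [b], so
    with high probability the fired set is no larger than the time and [card_closure_leq]
    applies. *)
Lemma closure_le_whp (b e : R) : 0 <= b <= 1 -> 1 - b < miss b -> 0 < e ->
  \forall n \near \oo, forall K : {set 'I_n.+1}, #|K| = k n ->
  #|[set w : (m n).-tuple (triple n) |
      (Num.truncn (b * N n) < #|horn_closure K w|)%N]%SET|%:R
  <= e * #|{: (m n).-tuple (triple n)}|%:R.
Proof.
move=> b01 mb e0; pose d := (miss b - (1 - b)) / 2.
have d0 : 0 < d by rewrite divr_gt0 // subr_gt0.
near=> n; have N0 : 0 < N n by rewrite ltr0n.
have N1 : 1 <= d * N n by near: n; apply: near_large.
set s := Num.truncn (b * _); have sn : (s <= n.+1)%N by apply: truncn_mul_leq.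
have conc : forall K : {set 'I_n.+1}, #|K| = k n ->
    #|[set w : (m n).-tuple (triple n) | d * N n <=
      `|#|~: fired K w s|%:R - miss b * N n| ]%SET|%:R
    <= e * #|{: (m n).-tuple (triple n)}|%:R.
  by rewrite /s; near: n; apply: unfired_concentration.
move=> K Kk; rewrite (card_closure_relabel _ K (fun C => s < #|C|)%N).
move: (conc K Kk); apply: le_trans; rewrite ler_nat; apply: subset_leq_card.
apply/fintype.subsetP => w; rewrite !inE => sC.
have sD : (s < #|fired K w s|)%N.
  by rewrite ltnNge; apply: contraL sC => /(card_closure_leq sn); rewrite -leqNgt.
have : (#|fired K w s| + #|~: fired K w s|)%:R = N n by rewrite cardsC card_ord.
have : (s.+1)%:R <= #|fired K w s|%:R :> R by rewrite ler_nat.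
have : b * N n < s.+1%:R.
  have /andP[b0 _] := b01.
  by have /andP[] := truncn_itv (mulr_ge0 b0 (ltW N0)).
rewrite natrD distrC => h1 h2 h3; apply: le_trans (ler_norm _).
have : miss b = 2 * d + (1 - b) by rewrite /d; field.
move=> ->; nra.
Unshelve. all: by end_near. Qed.

(** Here the fired set must stay ahead at all times up to [a * N n]. Since it grows with time, a
    finite grid and a union bound suffice. *)
Lemma closure_ge_whp (a h e : R) : 0 <= a <= 1 -> 0 < h ->
  (forall t, 0 <= t <= a -> miss t + h <= 1 - t) -> 0 < e ->
  \forall n \near \oo, forall K : {set 'I_n.+1}, #|K| = k n ->
  #|[set w : (m n).-tuple (triple n) |
      (#|horn_closure K w| < Num.truncn (a * N n))%N]%SET|%:R
  <= e * #|{: (m n).-tuple (triple n)}|%:R.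
Proof.
(* The mesh [a / L%:R] is at most [h / 2], so half of the margin [h] survives between grid points;
   this exceeds the tolerance [h / 4] used at each of them. *)
move=> /andP[a0 a1] h0 mh e0; pose L := (Num.truncn (2 / h)).+1.
have L0 : 0 < L%:R :> R by rewrite ltr0n.
have Lh : 2 / h < L%:R.
  by have /andP[] := truncn_itv (divr_ge0 (ler0n R 2) (ltW h0)).
have aL : a / L%:R <= h / 2.
  by move: Lh; rewrite ltr_pdivrMr// ler_pdivrMr// => Lh; lra.
pose t (i : nat) : R := a * (i%:R / L%:R).
have t01 i : (i <= L)%N -> 0 <= t i <= a.
  move=> iL; rewrite /t mulr_ge0 ?divr_ge0//= ler_piMr// ler_pdivrMr//.
  by rewrite mul1r ler_nat.
have d0 : 0 < h / 4 by rewrite divr_gt0.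
have eL0 : 0 < e / L%:R by rewrite divr_gt0.
near=> n; have N0 : 0 < N n by rewrite ltr0n.
pose s i := Num.truncn (t i * N n).
have sn i : (i <= L)%N -> (s i <= n.+1)%N.
  by move=> iL; apply: truncn_mul_leq; have /andP[-> /= ta] := t01 i iL; apply: le_trans ta a1.
have sL : s L = Num.truncn (a * N n) by rewrite /s /t divff ?mulr1// gt_eqF.
pose B K (i : 'I_L) := [set w : (m n).-tuple (triple n) | h / 4 * N n <=
      `|#|~: fired K w (s i)|%:R - miss (t i) * N n| ]%SET.
have cB : forall (i : 'I_L) (K : {set 'I_n.+1}), #|K| = k n ->
    #|B K i|%:R <= e / L%:R * #|{: (m n).-tuple (triple n)}|%:R.
  rewrite /B /s; near: n; apply: filter_forall => i.
  apply: unfired_concentration => //.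
  by have /andP[-> /= ta] := t01 i (ltnW (ltn_ord i)); apply: le_trans ta a1.
move=> K Kk; rewrite -sL (card_closure_relabel _ K (fun C => #|C| < s L)%N).
apply: le_trans (_ : (\sum_(i < L) #|B K i|)%:R <= _); last first.
  rewrite natr_sum; apply: le_trans (ler_sum _ (fun i _ => cB i K Kk)) _.
  by rewrite sumr_const card_ord -[leLHS]mulr_natl mulrA mulrCA divff ?mulr1// gt_eqF.
rewrite ler_nat; apply: leq_trans (leq_card_bigcup _); apply: subset_leq_card.
apply/fintype.subsetP => w; rewrite inE => Cs.
(* A small closure forces some time [j] with too few fired variables; by monotonicity this already
   shows at the grid point just below [j]. *)
have [j js jD] : exists2 j, (j < s L)%N & (#|fired K w j| <= j)%N.
  apply/not_exists2P => H; move: Cs; rewrite ltnNge => /negP; apply.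
  apply: leq_card_closure; first exact: sn.
  by move=> j js; rewrite ltnNge; apply/negP => jD; case: (H j).
have s0 : (s 0 <= j)%N by rewrite /s /t mul0r mulr0 mul0r truncn0.
have [i iL /andP[sij jsi]] := nat_bracket s0 js.
apply/finset.bigcupP; exists (Ordinal iL) => //; rewrite inE /=.
have : (#|fired K w (s i)| + #|~: fired K w (s i)|)%:R = N n by rewrite cardsC card_ord.
have : (#|fired K w (s i)|)%:R <= (s i.+1)%:R :> R.
  rewrite ler_nat; apply: leq_trans (ltnW jsi); apply: leq_trans jD.
  exact/subset_leq_card/fired_mono.
have : (s i.+1)%:R <= t i.+1 * N n.
  have /andP[ti _] := t01 _ iL.
  by have /andP[] := truncn_itv (mulr_ge0 ti (ltW N0)).
have -> : t i.+1 = t i + a / L%:R by rewrite /t -natr1; field; rewrite gt_eqF.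
have := mh _ (t01 _ (ltnW iL)).
rewrite natrD => h1 h2 h3 h4; apply: le_trans (ler_norm _).
nra.
Unshelve. all: by end_near. Qed.

End ClosureSize.

(** * Probability of satisfiability *)

Definition sat_triples n m (K : {set 'I_n.+1}) :
    {set m.-tuple ('I_n.+1 * 'I_n.+1 * 'I_n.+1)} :=
  [set w : m.-tuple ('I_n.+1 * 'I_n.+1 * 'I_n.+1) |
    all [in distinct3 n] w & ord0 \notin horn_closure K w]%SET.

(** For fixed [K] the proportions among lists of distinct triples and among lists of clauses agree,
    the factor [2 ^ m] cancelling. The ratio averages them over [K], so common bounds pass to it. *)
Lemma sat_ratio_bounds (R : realType) n k m (lo hi : R) : (k <= n)%N ->
  (0 < #|distinct3 n| ^ m)%N ->
  (forall K : {set 'I_n.+1}, ord0 \notin K -> #|K| = k ->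
     lo * (#|distinct3 n| ^ m)%:R <= #|sat_triples m K|%:R
       <= hi * (#|distinct3 n| ^ m)%:R) ->
  lo <= sat_ratio R n k m <= hi.
Proof.
move=> kn D0 bnd; set H := #|[set w : m.-tuple (clause n.+1) | all [in horn3 n.+1] w]%SET|.
have card2 (P : pred ({set 'I_n.+1} * m.-tuple (clause n.+1))) :
    #|[set w in outcomes n k m | P w]%SET| =
    (\sum_(K : {set 'I_n.+1} | (ord0 \notin K) && (#|K| == k))
       #|[set v : m.-tuple (clause n.+1) | all [in horn3 n.+1] v & P (K, v)]%SET|)%N.
  under eq_bigr do rewrite -sum1_card.
  rewrite pair_big_dep /= -sum1_card; apply: eq_bigl => -[K v].
  by rewrite !inE /= -!andbA.
have DH : (#|distinct3 n| ^ m = H * 2 ^ m)%N.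
  rewrite -card_tuple_all.
  rewrite (_ : finset _ = [set w : m.-tuple _ | all [in distinct3 n] w & true]%SET);
    last by apply/finset.setP => w; rewrite !inE andbT.
  rewrite (card_tuple_fibers xpredT (@clause_of_horn3 n) (@card_clause_of_fiber n)).
  by congr (_ * _)%N; apply: eq_card => w; rewrite !inE andbT.
have DS (K : {set 'I_n.+1}) : #|sat_triples m K| =
    (#|[set v : m.-tuple (clause n.+1) | all [in horn3 n.+1] v &
        satisfiable (horn_formula (K, v))]%SET| * 2 ^ m)%N.
  rewrite -(card_tuple_fibers _ (@clause_of_horn3 n) (@card_clause_of_fiber n)).
  by apply: eq_card => w; rewrite !inE satisfiableE inE.
have p0 : 0 < (2 ^ m)%:R :> R by rewrite ltr0n expn_gt0.
have H0 : (0 < H)%N by move: D0; rewrite DH muln_gt0 => /andP[].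
have Hbnd (K : {set 'I_n.+1}) : (ord0 \notin K) && (#|K| == k) ->
    lo * H%:R <= #|[set v : m.-tuple (clause n.+1) | all [in horn3 n.+1] v &
        satisfiable (horn_formula (K, v))]%SET|%:R <= hi * H%:R.
  move=> /andP[K0 /eqP Kk]; have := bnd K K0 Kk.
  by rewrite DS DH !natrM !mulrA !ler_pM2r.
pose c := #|[set K : {set 'I_n.+1} | (ord0 \notin K) && (#|K| == k)]%SET|.
have c0 : (0 < c)%N.
  rewrite -(bin_gt0 n k) in kn; move: kn; congr (0 < _)%N.
  rewrite -[n in LHS](_ : #|~: [set (ord0 : 'I_n.+1)]%SET| = n); last first.
    by rewrite cardsC1 card_ord.
  rewrite -cards_draws; apply: eq_card => K.
  by rewrite !inE finset.subsetC finset.sub1set inE.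
have oE : #|outcomes n k m|%:R = c%:R * H%:R :> R.
  have -> : outcomes n k m = [set w in outcomes n k m | xpredT w]%SET.
    by apply/finset.setP => w; rewrite !inE andbT.
  rewrite card2 (eq_bigr (fun=> H)) => [|K _]; last first.
    by apply: eq_card => v; rewrite !inE andbT.
  by rewrite -natrM /c -sum_nat_const; congr (_%:R); apply: eq_bigl => K; rewrite !inE.
have o0 : 0 < c%:R * H%:R :> R by rewrite mulr_gt0 ?ltr0n.
have cE x : x * (c%:R * H%:R) =
    \sum_(K : {set 'I_n.+1} | (ord0 \notin K) && (#|K| == k)) x * H%:R :> R.
  rewrite sumr_const -[RHS]mulr_natl mulrCA; congr (_%:R * _).
  by apply: eq_card => K; rewrite !inE.
rewrite /sat_ratio oE (card2 (fun w => satisfiable (horn_formula w))) natr_sum.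
rewrite ler_pdivlMr// ler_pdivrMr// !cE; apply/andP; split.
  by apply: ler_sum => K /Hbnd /andP[].
by apply: ler_sum => K /Hbnd /andP[].
Qed.

Lemma sum_distinct1 (R : realType) n m :
  \sum_(w : m.-tuple ('I_n.+1 * 'I_n.+1 * 'I_n.+1) | all [in distinct3 n] w) 1 =
  (#|distinct3 n| ^ m)%:R :> R.
Proof.
by rewrite sumr_const -card_tuple_all; congr (_ *+ _); apply: eq_card => w; rewrite !inE.
Qed.

(** Conditioning on an event of probability at least [c] multiplies probabilities by at most [c^-1];
    hence the factor [f * c] in the hypothesis. *)
Lemma sum_distinct_indicator (R : realType) n m (c f : R)
    (P : pred (m.-tuple ('I_n.+1 * 'I_n.+1 * 'I_n.+1))) : 0 <= f ->
  c * #|{: m.-tuple ('I_n.+1 * 'I_n.+1 * 'I_n.+1)}|%:R <= (#|distinct3 n| ^ m)%:R ->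
  #|[set w : m.-tuple _ | P w]%SET|%:R <= f * c * #|{: m.-tuple ('I_n.+1 * 'I_n.+1 * 'I_n.+1)}|%:R ->
  \sum_(w : m.-tuple _ | all [in distinct3 n] w) (P w)%:R <= f * (#|distinct3 n| ^ m)%:R.
Proof.
move=> f0 dist Pf; apply: le_trans (ler_wpM2l f0 dist).
rewrite mulrA; apply: le_trans Pf; rewrite -natr_sum ler_nat.
rewrite -sum1_card [leqRHS]big_mkcond /= big_mkcond /=; apply: leq_sum => w _.
by rewrite inE; case: (all _ w); case: (P w).
Qed.

Section SatProb.

Variables (R : realType) (d1 d3 : R).
Hypotheses (d1_ge0 : 0 <= d1) (d1_lt1 : d1 < 1) (d3_ge0 : 0 <= d3).

Local Notation N n := (n.+1%:R : R).
Local Notation k n := (Num.truncn (d1 * N n)).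
Local Notation m n := (Num.truncn (d3 * N n)).
Local Notation triple n := ('I_n.+1 * 'I_n.+1 * 'I_n.+1)%type.
Local Notation miss := (miss d1 d3).

(* A triple has distinct entries with probability 1 - O(1/N), so that all the
   O(N) triples do with a probability bounded away from 0. *)
Lemma distinct3_frequency : exists2 c : R, 0 < c &
  \forall n \near \oo,
    c * #|{: (m n).-tuple (triple n)}|%:R <= (#|distinct3 n| ^ m n)%:R.
Proof.
(* The probability that a uniform triple has a repeated entry, [1 - (1 - 1/N) * (1 - 2/N)]. *)
pose x n : R := 3 * harmonic n - 2 * (harmonic n * harmonic n).
have xl : x @ \oo --> 0.
  rewrite /x -[0](_ : 3 * 0 - 2 * (0 * 0) = _); last by ring.
  apply: cvgB; apply: cvgM; try exact: cvg_cst; try exact: cvg_harmonic.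
  by apply: cvgM; exact: cvg_harmonic.
have mxl : (m n)%:R * x n @[n --> \oo] --> d3 * 3.
  have -> : (fun n => (m n)%:R * x n) =
      (fun n => (m n)%:R / N n * (3 - 2 * harmonic n)).
    by apply/funext => n; rewrite /x /harmonic /=; ring.
  apply: cvgM; first exact: cvg_truncn_div.
  rewrite -[X in _ --> X]subr0 -[X in _ - X](mulr0 2).
  apply: cvgB; first exact: cvg_cst.
  by apply: cvgM; [exact: cvg_cst|exact: cvg_harmonic].
have x0 n : 0 <= x n.
  rewrite /x mulrA -mulrBl mulr_ge0 ?invr_ge0 ?ler0n// subr_ge0.
  have : (harmonic n : R) <= 1 by rewrite invf_le1 ?ler1n ?ltr0n.
  lra.
have := cvg_expr_exp x0 xl mxl; set l := expR _ => ql.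
have l0 : 0 < l by apply: expR_gt0.
exists (l / 2); first by rewrite divr_gt0.
near=> n; have N0 : 0 < N n by rewrite ltr0n.
have lq : l / 2 < (1 - x n) ^+ m n.
  near: n; apply: (cvgr_gt l) => //; rewrite ltr_pdivrMr//; lra.
rewrite card_distinct3 natrX.
have -> : (n.+1 ^_ 3)%:R = N n ^+ 3 * (1 - x n).
  rewrite !ffactnS ffactn0 muln1 !natrM /x /harmonic /=.
  (* At [n = 0] the predecessor is truncated, but both sides vanish. *)
  have [->|n0] := posnP n; first by rewrite /=; field.
  rewrite -subn1 natrB// -[n.+1]addn1 natrD; field.
  by rewrite natr1.
rewrite card_tuple !card_prod !card_ord natrX !natrM.
rewrite (_ : N n * N n * N n = N n ^+ 3); last by ring.
rewrite [leRHS]exprMn [leLHS]mulrC.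
by rewrite ler_wpM2l ?exprn_ge0 ?ltW// exprn_gt0.
Unshelve. all: by end_near. Qed.

Lemma sat_triples_double_count n (K : {set 'I_n.+1}) : ord0 \notin K ->
  #|sat_triples (m n) K|%:R * #|~: K|%:R =
  \sum_(w : (m n).-tuple (triple n) | all [in distinct3 n] w)
     #|~: horn_closure K w|%:R :> R.
Proof. by move=> K0; rewrite -natrM card_sat_double_count// natr_sum. Qed.

Lemma card_compl n (K : {set 'I_n.+1}) : #|~: K|%:R = N n - #|K|%:R.
Proof.
have : (#|K| + #|~: K|)%:R = N n by rewrite cardsC card_ord.
by rewrite natrD => <-; rewrite addrC addKr.
Qed.

Lemma card_compl_ge n (K : {set 'I_n.+1}) : #|K| = k n ->
  (1 - d1) * N n <= #|~: K|%:R <= (1 - d1) * N n + 1.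
Proof.
move=> Kk; have /andP[] := truncn_itv (mulr_ge0 d1_ge0 (ler0n R n.+1)).
rewrite card_compl Kk -natr1; set x := (Num.truncn _)%:R; lra.
Qed.

(** Outside exceptional lists the closure has about [a * N n] elements or more, which bounds the
    average number of underived variables. One half of [e] covers rounding, the other the
    exceptional lists. *)
Lemma sat_prob_le (a h e : R) : 0 <= a <= 1 -> 0 < h ->
  (forall t, 0 <= t <= a -> miss t + h <= 1 - t) -> 0 < e ->
  \forall n \near \oo, sat_prob d1 d3 n <= (1 - a) / (1 - d1) + e.
Proof.
move=> a01 h0 mh e0; have [c c0 freq] := distinct3_frequency.
have e20 : 0 < e / 2 by rewrite divr_gt0.
have D0 : 0 < 1 - d1 by rewrite subr_gt0.
near=> n; have N0 : 0 < N n by rewrite ltr0n.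
have dist : c * #|{: (m n).-tuple (triple n)}|%:R <= (#|distinct3 n| ^ m n)%:R.
  by near: n.
have N1 : 1 <= e / 2 * (1 - d1) * N n by near: n; apply: near_large; rewrite mulr_gt0.
have size : forall K : {set 'I_n.+1}, #|K| = k n ->
    #|[set w : (m n).-tuple (triple n) |
      (#|horn_closure K w| < Num.truncn (a * N n))%N]%SET|%:R
    <= e / 2 * c * #|{: (m n).-tuple (triple n)}|%:R.
  by near: n; apply: closure_ge_whp (mh) _; rewrite ?mulr_gt0.
have M0 : 0 < #|{: (m n).-tuple (triple n)}|%:R :> R.
  by rewrite ltr0n card_tuple expn_gt0 !card_prod !card_ord !muln_gt0.
have Dm0 : 0 < (#|distinct3 n| ^ m n)%:R :> R.
  by apply: lt_le_trans dist; rewrite mulr_gt0.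
suff /andP[_] : 0 <= sat_ratio R n (k n) (m n) <= (1 - a) / (1 - d1) + e by [].
apply: sat_ratio_bounds; first by rewrite -ltnS truncn_mul_lt.
  by rewrite -(ltr_nat R).
move=> K K0 Kk; rewrite mul0r ler0n /=.
have /andP[cK _] := card_compl_ge Kk.
have cK0 : 0 < #|~: K|%:R :> R by apply: lt_le_trans cK; rewrite mulr_gt0.
rewrite -(ler_pM2r cK0) sat_triples_double_count//.
set D := (_ ^ _)%:R in dist Dm0 *.
pose s := Num.truncn (a * N n).
have aN : a * N n - 1 <= s%:R.
  have /andP[a0 _] := a01.
  have /andP[_] := truncn_itv (mulr_ge0 a0 (ltW N0)).
  by rewrite -/s -[s.+1%:R]natr1; lra.
have KC w : (#|~: horn_closure K w| <= #|~: K|)%N.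
  rewrite subset_leq_card// finset.setCS; apply: sub_horn_closure => X.
  by case/andP.
(* Outside the exceptional lists at most [N n - s] variables are underived; on them the trivial
   bound [#|~: K|] is used. *)
apply: le_trans (_ : \sum_(w : (m n).-tuple (triple n) | all [in distinct3 n] w)
   ((N n - s%:R) * 1 + (#|horn_closure K w| < s)%N%:R * #|~: K|%:R) <= _).
  apply: ler_sum => w _; rewrite mulr1; have [lt_s|le_s] := ltnP.
    have CK : #|~: horn_closure K w|%:R <= #|~: K|%:R :> R by rewrite ler_nat.
    rewrite mul1r; apply: le_trans CK _; rewrite lerDr subr_ge0 ler_nat.
    exact: truncn_mul_leq.
  rewrite mul0r addr0 card_compl; apply: lerB => //.
  by rewrite ler_nat.
rewrite big_split /= -mulr_sumr -mulr_suml sum_distinct1 -/D.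
have bad : \sum_(w : (m n).-tuple (triple n) | all [in distinct3 n] w)
    (#|horn_closure K w| < s)%N%:R <= e / 2 * D.
  exact: sum_distinct_indicator (ltW e20) dist (size K Kk).
have : (N n - s%:R) * D <= ((1 - a) / (1 - d1) + e / 2) * #|~: K|%:R * D.
  rewrite ler_pM2r//.
  have : (1 - a) / (1 - d1) * ((1 - d1) * N n) <= (1 - a) / (1 - d1) * #|~: K|%:R.
    by rewrite ler_wpM2l// divr_ge0 ?subr_ge0 ?(ltW d1_lt1)//; by have /andP[] := a01.
  rewrite mulrA divfK ?gt_eqF// mulrDl => h1.
  have h2 : e / 2 * ((1 - d1) * N n) <= e / 2 * #|~: K|%:R by rewrite ler_wpM2l// ltW.
  lra.
have := ler_wpM2r (ltW cK0) bad.
set x := #|~: K|%:R; set y := \sum_(_ | _) _.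
move=> h1 h2; apply: le_trans (lerD h2 h1) _.
by rewrite le_eqVlt; apply/orP; left; apply/eqP; field; rewrite gt_eqF.
Unshelve. all: by end_near. Qed.

Lemma sat_prob_ge (b e : R) : 0 <= b <= 1 -> 1 - b < miss b -> 0 < e ->
  \forall n \near \oo, (1 - b) / (1 - d1) - e <= sat_prob d1 d3 n.
Proof.
move=> b01 mb e0; have [c c0 freq] := distinct3_frequency.
have D0 : 0 < 1 - d1 by rewrite subr_gt0.
pose B := (1 - b) / (1 - d1).
have B0 : 0 <= B by rewrite divr_ge0 ?subr_ge0 ?(ltW d1_lt1)//; case/andP: b01.
(* A loss of [B * f * (1 - d1) * N n] occurs at most twice, for the exceptional lists and for the
   rounding of [k n]; [f * (B + 1) = e / 2] keeps the total within [e], and the [+ 1] avoids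
   division by zero. *)
pose f := e / 2 / (B + 1).
have f0 : 0 < f by rewrite !divr_gt0// ltr_wpDl.
near=> n; have N0 : 0 < N n by rewrite ltr0n.
have dist : c * #|{: (m n).-tuple (triple n)}|%:R <= (#|distinct3 n| ^ m n)%:R.
  by near: n.
have N1 : 1 <= f * (1 - d1) * N n by near: n; apply: near_large; rewrite mulr_gt0.
have size : forall K : {set 'I_n.+1}, #|K| = k n ->
    #|[set w : (m n).-tuple (triple n) |
      (Num.truncn (b * N n) < #|horn_closure K w|)%N]%SET|%:R
    <= f * c * #|{: (m n).-tuple (triple n)}|%:R.
  by near: n; apply: closure_le_whp => //; apply: mulr_gt0.
have M0 : 0 < #|{: (m n).-tuple (triple n)}|%:R :> R.
  by rewrite ltr0n card_tuple expn_gt0 !card_prod !card_ord !muln_gt0.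
have Dm0 : 0 < (#|distinct3 n| ^ m n)%:R :> R.
  by apply: lt_le_trans dist; rewrite mulr_gt0.
suff /andP[] : (1 - b) / (1 - d1) - e <= sat_ratio R n (k n) (m n) <= 1 by [].
apply: sat_ratio_bounds; first by rewrite -ltnS truncn_mul_lt.
  by rewrite -(ltr_nat R).
move=> K K0 Kk; apply/andP; split; last first.
  rewrite mul1r ler_nat -card_tuple_all subset_leq_card//.
  by apply/fintype.subsetP => w; rewrite !inE => /andP[].
have /andP[cK cK'] := card_compl_ge Kk.
have cK0 : 0 < #|~: K|%:R :> R by apply: lt_le_trans cK; rewrite mulr_gt0.
rewrite -(ler_pM2r cK0) sat_triples_double_count//.
set D := (_ ^ _)%:R in dist Dm0 *.
rewrite -/B.
(* If [B <= e] the left side is nonpositive; otherwise the choice of [f] yields [f <= 1], which is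
   used below. *)
have [Be|eB] := leP B e.
  apply: (@le_trans _ _ 0); last exact: sumr_ge0.
  by rewrite -mulrA mulr_le0_ge0 ?subr_le0// mulr_ge0// ltW.
pose s := Num.truncn (b * N n).
have bN : s%:R <= b * N n.
  have /andP[b0 _] := b01.
  by have /andP[] := truncn_itv (mulr_ge0 b0 (ltW N0)).
have bad : \sum_(w : (m n).-tuple (triple n) | all [in distinct3 n] w)
    (s < #|horn_closure K w|)%N%:R <= f * D.
  exact: sum_distinct_indicator (ltW f0) dist (size K Kk).
have sN : s%:R <= N n by rewrite ler_nat; apply: truncn_mul_leq.
apply: le_trans (_ : _ <= \sum_(w : (m n).-tuple (triple n) | all [in distinct3 n] w)
   (N n - s%:R) * (1 - (s < #|horn_closure K w|)%N%:R)) _; last first.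
  apply: ler_sum => w _; have [lt_s|le_s] := ltnP.
    by rewrite subrr mulr0.
  by rewrite subr0 mulr1 card_compl lerB// ler_nat.
rewrite -mulr_sumr sumrB sum_distinct1 -/D.
apply: le_trans (_ : _ <= (N n - s%:R) * (D - f * D)) _; last first.
  by rewrite ler_wpM2l ?subr_ge0// lerB.
have -> : (N n - s%:R) * (D - f * D) = (N n - s%:R) * (1 - f) * D by ring.
have fB : f * (B + 1) = e / 2 by rewrite /f divfK// gt_eqF// ltr_wpDl.
have BE : (1 - b) * N n = B * ((1 - d1) * N n) by rewrite mulrA divfK// gt_eqF.
rewrite mulrAC ler_pM2r//; move: cK cK' N1; rewrite -mulrA.
move: BE; set y := (1 - d1) * N n; set z := #|~: K|%:R => BE cK cK' N1.
have f1 : f <= 1 by nra.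
apply: (@le_trans _ _ (B * y * (1 - f))); last first.
  by rewrite ler_wpM2r ?subr_ge0// -BE; lra.
nra.
Unshelve. all: by end_near. Qed.

End SatProb.

(** * The function whose level sets give the roots *)

Section Curve.

Variable R : realType.
Implicit Types (d t : R).

(** The root equation in exponential form is [phi d3 t = 1 - d1], and [miss d1 d3 t < 1 - t] amounts
    to [1 - d1 < phi d3 t]. *)
Definition phi d t : R := (1 - t) * expR (d * t ^+ 2).

Lemma is_derive_phi d t :
  is_derive t 1 (phi d) (expR (d * t ^+ 2) * (2 * d * t * (1 - t) - 1)).
Proof.
have h : is_derive t 1 ((cst 1 - @id R) * (expR \o (d \*: (@id R ^+ 2))))
    (expR (d * t ^+ 2) * (2 * d * t * (1 - t) - 1)).
  apply: is_derive_eq.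
  rewrite [LHS](_ : _ = (1 - t) * (expR (d * t ^+ 2) * (d * (2 * t * 1))) +
    expR (d * t ^+ 2) * (0 - 1))//; by ring.
exact: h.
Qed.

Lemma continuous_phi d : continuous (phi d).
Proof.
move=> t; apply: differentiable_continuous; apply/derivable1_diffP.
by have [] := is_derive_phi d t.
Qed.

Lemma phi_MVT d x y : x < y -> exists2 c, x < c < y &
  phi d y - phi d x = expR (d * c ^+ 2) * (2 * d * c * (1 - c) - 1) * (y - x).
Proof.
move=> xy.
have hd c : c \in `]x, y[ -> is_derive c 1 (phi d)
    (expR (d * c ^+ 2) * (2 * d * c * (1 - c) - 1)).
  by move=> _; apply: is_derive_phi.
have [|c] := MVT xy hd; first exact/continuous_subspaceT/continuous_phi.
by rewrite in_itv /= => cxy ->; exists c.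
Qed.

Lemma phi_decr d x y : x < y ->
  (forall c, x < c < y -> 2 * d * c * (1 - c) < 1) -> phi d y < phi d x.
Proof.
move=> xy h; have [c cxy e] := phi_MVT d xy.
have : phi d y - phi d x < 0; last by rewrite subr_lt0.
by rewrite e pmulr_llt0 ?subr_gt0// pmulr_rlt0 ?expR_gt0// subr_lt0 h.
Qed.

Lemma phi_incr d x y : x < y ->
  (forall c, x < c < y -> 1 <= 2 * d * c * (1 - c)) -> phi d x <= phi d y.
Proof.
move=> xy h; have [c cxy e] := phi_MVT d xy.
by rewrite -subr_ge0 e !mulr_ge0 ?expR_ge0// subr_ge0 ?(ltW xy)// h.
Qed.

Lemma phi0 d : phi d 0 = 1.
Proof. by rewrite /phi expr0n mulr0 expR0 mulr1 subr0. Qed.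

Lemma phi1 d : phi d 1 = 0.
Proof. by rewrite /phi subrr mul0r. Qed.

(** For [2 <= d] the critical points of [phi d] solve [2 * d * t * (1 - t) = 1]; they are symmetric
    about [1 / 2] and at distance [crit_gap d] from each other. *)
Definition crit_gap d : R := Num.sqrt (1 - 2 / d).
Definition crit_min d : R := (1 - crit_gap d) / 2.
Definition crit_max d : R := (1 + crit_gap d) / 2.

Lemma crit_gap_bounds d : 2 <= d -> 0 <= crit_gap d < 1.
Proof.
move=> d2; rewrite sqrtr_ge0 /= -[ltRHS]sqrtr1 ltr_sqrt//.
by rewrite gtrBl divr_gt0// (lt_le_trans _ d2).
Qed.

Lemma crit_gap_sqr d : 2 <= d -> d * crit_gap d ^+ 2 = d - 2.
Proof.
move=> d2; have d0 : 0 < d by lra.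
rewrite sqr_sqrtr; first by field; rewrite gt_eqF.
by rewrite subr_ge0 ler_pdivrMr// mul1r.
Qed.

Lemma crit_gap_gt0 d : 2 < d -> 0 < crit_gap d.
Proof.
move=> d2; rewrite sqrtr_gt0 subr_gt0 ltr_pdivrMr ?mul1r//; lra.
Qed.

Lemma phi_slope d t : 2 <= d -> 2 * d * t * (1 - t) - 1 =
  2 * d * (t - crit_min d) * (crit_max d - t).
Proof.
move=> d2; have := crit_gap_sqr d2; rewrite /crit_min /crit_max.
by set s := crit_gap d => e; lra.
Qed.

End Curve.

(** * Monotonicity intervals and the first crossing of a level *)

Section Crossing.

Variable R : realType.
Implicit Types (d t : R).

Lemma crit_order d : 2 <= d ->
  [/\ 0 < crit_min d, crit_min d <= crit_max d & crit_max d < 1].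
Proof.
by move=> /crit_gap_bounds/andP[]; rewrite /crit_min /crit_max; split; lra.
Qed.

Lemma crit_lt d : 2 < d -> crit_min d < crit_max d.
Proof. by move=> /crit_gap_gt0; rewrite /crit_min /crit_max; lra. Qed.

Lemma phi_decr_left d x y : 2 <= d -> x < y -> y <= crit_min d ->
  phi d y < phi d x.
Proof.
move=> d2 xy ym; apply: phi_decr => // c /andP[xc cy].
have [m0 mM M1] := crit_order d2; have := phi_slope c d2.
have : 0 < 2 * d * (crit_min d - c) * (crit_max d - c).
  by rewrite !mulr_gt0 ?subr_gt0//; lra.
lra.
Qed.

Lemma phi_decr_right d x y : 2 <= d -> crit_max d <= x -> x < y ->
  phi d y < phi d x.
Proof.
move=> d2 xM xy; apply: phi_decr => // c /andP[xc cy].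
have [m0 mM M1] := crit_order d2; have := phi_slope c d2.
have : 0 < 2 * d * (c - crit_min d) * (c - crit_max d).
  by rewrite !mulr_gt0 ?subr_gt0//; lra.
lra.
Qed.

Lemma phi_incr_mid d x y : 2 <= d -> crit_min d <= x -> x <= y ->
  y <= crit_max d -> phi d x <= phi d y.
Proof.
move=> d2 mx; rewrite le_eqVlt => /predU1P[->//|xy] yM.
apply: phi_incr => // c /andP[xc cy]; have := phi_slope c d2.
have : 0 <= 2 * d * (c - crit_min d) * (crit_max d - c).
  by rewrite !mulr_ge0 ?subr_ge0//; lra.
lra.
Qed.

(** At [d = 2] the derivative vanishes at [1 / 2], so strict decrease is proved on each side of this
    point and then glued. *)
Lemma phi_decr_subcritical d x y : 0 <= d <= 2 -> x < y -> phi d y < phi d x.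
Proof.
move=> /andP[d0 d2].
have half u v : u < v -> v <= 1 / 2 \/ 1 / 2 <= u -> phi d v < phi d u.
  move=> uv uv2; apply: phi_decr => // c /andP[uc cv].
  have : 0 < (c - 1 / 2) ^+ 2.
    by rewrite exprn_even_gt0//= subr_eq0; case: uv2 => ?; apply/eqP; lra.
  have -> : (c - 1 / 2) ^+ 2 = 1 / 4 - c * (1 - c) by field.
  rewrite -!mulrA; set q := c * _ => q4; have [q0|q0] := leP q 0.
    by have := mulr_ge0_le0 d0 q0; lra.
  have : d * q <= 2 * q by rewrite ler_pM2r.
  lra.
move=> xy; have [y2|y2] := leP y (1 / 2); first by apply: half; [|left].
have [x2|x2] := leP (1 / 2) x; first by apply: half; [|right].
by apply: (@lt_trans _ _ (phi d (1 / 2))); apply: half => //; [right|left].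
Qed.

(** With [s = crit_gap d] one has [d * s ^+ 2 = d - 2], which turns [Num.sqrt (d * (d - 2))] into
    [d * s] and the factor [(1 + s) / 2] of [phi] into [(d - d * s)^-1]. *)
Lemma Gamma_d1E d : 2 <= d -> Gamma_d1 d = 1 - phi d (crit_min d).
Proof.
move=> d2; have d0 : 0 < d by lra.
have /andP[s0 s1] := crit_gap_bounds d2; have := crit_gap_sqr d2.
rewrite /Gamma_d1 /phi /crit_min; set s := crit_gap d in s0 s1 * => e.
have q : Num.sqrt (d * (d - 2)) = d * s.
  rewrite -e mulrA -expr2 sqrtrM ?sqr_ge0// !sqrtr_sqr.
  by rewrite !ger0_norm// ltW.
have -> : (Num.sqrt d - Num.sqrt (d - 2)) ^+ 2 = 2 * d - 2 - 2 * (d * s).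
  rewrite sqrrB sqr_sqrtr ?ltW// sqr_sqrtr ?subr_ge0// -sqrtrM ?ltW// q; lra.
rewrite q; congr (1 - _).
have -> : d * ((1 - s) / 2) ^+ 2 = 4^-1 * (2 * d - 2 - 2 * (d * s)) by lra.
rewrite mulrC; congr (_ * _).
have ds : d - d * s != 0 by rewrite -[X in X - _]mulr1 -mulrBr mulf_neq0 ?gt_eqF// subr_gt0.
apply: (mulIf ds); rewrite mulVf//; lra.
Qed.

Lemma Gamma_d1_bounds d : 2 <= d -> 0 < Gamma_d1 d < 1.
Proof.
move=> d2; have [m0 mM M1] := crit_order d2.
rewrite Gamma_d1E// subr_gt0 gtrBl -{1}(phi0 d) phi_decr_left//=.
by rewrite /phi mulr_gt0 ?expR_gt0// subr_gt0; lra.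
Qed.

(** Strictness before [t], together with values below the level arbitrarily close after [t],
    excludes mere touching and makes the crossing stable when the parameters move. *)
Definition crossing (d1 d3 t : R) : Prop :=
  [/\ 0 <= t < 1, forall s, 0 <= s < t -> 1 - d1 < phi d3 s &
      forall e, 0 < e -> exists2 b, t < b < t + e & b <= 1 /\ phi d3 b < 1 - d1].

Lemma crossing_decr (d1 d3 a z : R) : 0 <= a < z -> z <= 1 ->
  (forall x y, a <= x -> x < y -> y <= z -> phi d3 y < phi d3 x) ->
  phi d3 z < 1 - d1 <= phi d3 a ->
  (forall s, 0 <= s < a -> 1 - d1 < phi d3 s) ->
  exists t, crossing d1 d3 t.
Proof.
move=> /andP[a0 az] z1 dec /andP[zd da] sa.
have [|t] := @IVT _ (phi d3) a z (1 - d1) (ltW az)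
    (continuous_subspaceT (@continuous_phi _ d3)).
  by rewrite ge_min le_max da (ltW zd) orbT.
rewrite in_itv /= => /andP[at_ tz] tE.
have {}tz : t < z by rewrite lt_neqAle tz andbT; apply: contraTneq zd => <-; rewrite tE ltxx.
exists t; split; first by rewrite (le_trans a0)// (lt_le_trans tz).
  move=> s /andP[s0 st]; have [sa'|as_] := ltP s a; first by apply: sa; rewrite s0.
  by rewrite -tE; apply: dec => //; apply: ltW.
move=> e e0; exists (Num.min z (t + e / 2)).
  by rewrite lt_min tz /= ltrDl divr_gt0//= gt_min; apply/orP; right; lra.
split; first by rewrite ge_min z1.
by rewrite -tE; apply: dec; rewrite // ?ge_min ?lexx// lt_min tz ltrDl divr_gt0.
Qed.

(** For [d3 <= 2] the function decreases throughout. For [2 < d3] a level above the local minimum is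
    crossed before [crit_min], a level below it only after [crit_max]; equality is the excluded
    curve. *)
Lemma crossing_exists (p : R * R) : parameters R p ->
  ~ (Gamma R `\ critical_point R) p -> exists t, crossing p.1 p.2 t.
Proof.
case: p => d1 d3 [/= /andP[d10 d11] d30] nG.
have [d32|d32] := leP d3 2.
  apply: (@crossing_decr _ _ 0 1); rewrite ?lexx ?ltr01//.
  - by move=> x y _ xy _; apply: phi_decr_subcritical; rewrite ?d30.
  - by rewrite phi0 phi1; apply/andP; split; lra.
  - by move=> s; case: ltgtP.
have d2 := ltW d32; have [m0 mM M1] := crit_order d2.
have : 1 - d1 != phi d3 (crit_min d3).
  apply/eqP => e; apply: nG; split; first by split => //=; rewrite Gamma_d1E// -e; lra.
  by move=> /(congr1 snd) /= d3E; rewrite d3E ltxx in d32.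
rewrite neq_lt => /orP[lt_m|gt_m].
  apply: (@crossing_decr _ _ (crit_max d3) 1) => //.
  - by rewrite M1 andbT; lra.
  - by move=> x y Mx xy _; apply: phi_decr_right.
  - rewrite phi1 subr_gt0 d11 /=; apply: le_trans (ltW lt_m) _.
    exact: phi_incr_mid.
  - move=> s /andP[s0 sM]; apply: lt_le_trans lt_m _.
    have [sm|ms] := ltP s (crit_min d3); last by apply: phi_incr_mid => //; apply: ltW.
    by apply/ltW/phi_decr_left.
apply: (@crossing_decr _ _ 0 (crit_min d3)) => //.
- by rewrite lexx.
- lra.
- by move=> x y _ xy ym; apply: phi_decr_left.
- by rewrite gt_m phi0 gerBl.
- by move=> s; case: ltgtP.
Qed.

End Crossing.

(** * The limit probability *)

Lemma cluster_le (R : realType) (u : R^nat) (l c : R) :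
  cluster (u @ \oo) l -> (\forall n \near \oo, u n <= c) -> l <= c.
Proof.
move=> ul uc; rewrite leNgt; apply/negP => cl.
have [x [/= xc cx]] := ul [set x | x <= c] [set x | c < x] uc (lt_nbhsr cl).
by rewrite ltNge xc in cx.
Qed.

Lemma cluster_ge (R : realType) (u : R^nat) (l c : R) :
  cluster (u @ \oo) l -> (\forall n \near \oo, c <= u n) -> c <= l.
Proof.
move=> ul uc; rewrite leNgt; apply/negP => lc.
have [x [/= cx xc]] := ul [set x | c <= x] [set x | x < c] uc (lt_nbhsl lc).
by rewrite ltNge cx in xc.
Qed.

Section Limits.

Variable R : realType.
Implicit Types (p q : R * R) (d t a b e : R).

(** Compactness turns the strict inequality into a uniform margin. *)
Lemma phi_gap (d1 d3 : R) a : 0 <= a ->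
  (forall s, 0 <= s <= a -> 1 - d1 < phi d3 s) ->
  exists2 g, 0 < g & forall s, 0 <= s <= a -> 1 - d1 + g <= phi d3 s.
Proof.
move=> a0 sa; have [c ca cmin] := EVT_min a0
  (continuous_subspaceT (@continuous_phi _ d3)).
exists (phi d3 c - (1 - d1)).
  by rewrite subr_gt0 sa//; move: ca; rewrite in_itv.
by move=> s s0a; rewrite addrC subrK cmin// in_itv.
Qed.

Lemma parametersP p : parameters R p -> [/\ 0 <= p.1, p.1 < 1 & 0 <= p.2].
Proof. by move=> [/andP[]]. Qed.

Lemma sat_prob_phi_le p a e : parameters R p -> 0 <= a <= 1 ->
  (forall s, 0 <= s <= a -> 1 - p.1 < phi p.2 s) -> 0 < e ->
  \forall n \near \oo, sat_prob p.1 p.2 n <= (1 - a) / (1 - p.1) + e.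
Proof.
move=> /parametersP[p10 p11 p20] a01 sa e0; have /andP[a0 a1] := a01.
have [g g0 sg] := phi_gap a0 sa.
(* Passing from [phi] to [miss] multiplies the margin by [expR (- (p.2 * t ^+ 2))], which is at
   least [expR (- p.2)] on the unit interval. *)
apply: (sat_prob_le p10 p11 p20 a01 (h := expR (- p.2) * g)) => //.
  by rewrite mulr_gt0 ?expR_gt0.
move=> t /andP[t0 ta]; have := sg t; rewrite t0 ta => /(_ isT) gt.
have t1 : t <= 1 by apply: le_trans a1.
rewrite /miss -(ler_pM2r (expR_gt0 (p.2 * t ^+ 2))) -/(phi p.2 t); apply: le_trans gt.
rewrite [expR (- (_ * _))]expRN mulrDl divfK ?gt_eqF ?expR_gt0// lerD2l.
rewrite mulrAC -expRD ler_piMl ?(ltW g0)// -[leRHS]expR0 ler_expR.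
by rewrite addrC subr_le0 ler_piMr// exprn_ile1.
Qed.

Lemma sat_prob_phi_ge p b e : parameters R p -> 0 <= b <= 1 ->
  phi p.2 b < 1 - p.1 -> 0 < e ->
  \forall n \near \oo, (1 - b) / (1 - p.1) - e <= sat_prob p.1 p.2 n.
Proof.
move=> /parametersP[p10 p11 p20] b01 sb e0.
apply: (sat_prob_ge p10 p11 p20 b01) => //.
rewrite /miss -(ltr_pM2r (expR_gt0 (p.2 * b ^+ 2))) -/(phi p.2 b).
by rewrite expRN divfK// gt_eqF// expR_gt0.
Qed.

Lemma sat_prob_le1 p n : sat_prob p.1 p.2 n <= 1.
Proof.
rewrite /sat_prob /sat_ratio; set A := finset _; set B := outcomes _ _ _.
have [->|B0] := eqVneq #|B| 0%N; first by rewrite invr0 mulr0.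
rewrite ler_pdivrMr ?ltr0n ?lt0n// mul1r ler_nat subset_leq_card//.
by apply/fintype.subsetP => w; rewrite inE => /andP[].
Qed.

Lemma crossing_lower (d1 d3 : R) t e : d1 < 1 -> crossing d1 d3 t -> 0 < e ->
  exists b, [/\ 0 <= b <= 1, phi d3 b < 1 - d1 &
                (1 - t) / (1 - d1) - e < (1 - b) / (1 - d1)].
Proof.
move=> d11 [/andP[t0 t1] _ tb] e0; have D0 : 0 < 1 - d1 by rewrite subr_gt0.
have [b /andP[tlb blt] [b1 bphi]] := tb (e * (1 - d1)) (mulr_gt0 e0 D0).
exists b; split=> //; first by rewrite b1 andbT; lra.
by rewrite ltrBlDr -ltrBlDl -mulrBl ltr_pdivrMr//; lra.
Qed.

(** At [t = 0] no [a] need exist, as [phi d3 0 = 1] may equal [1 - d1]. The value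
    [(1 - t) / (1 - d1)] is then at least [1], and the trivial bound on probabilities takes over. *)
Lemma crossing_upper (d1 d3 : R) t e : d1 < 1 -> crossing d1 d3 t -> 0 < e ->
  t = 0 \/ exists a, [/\ 0 <= a <= 1, forall s, 0 <= s <= a -> 1 - d1 < phi d3 s &
                (1 - a) / (1 - d1) < (1 - t) / (1 - d1) + e].
Proof.
move=> d11 [/andP[t0 t1] st _] e0; have D0 : 0 < 1 - d1 by rewrite subr_gt0.
move: t0; rewrite le_eqVlt => /predU1P[<-|t0]; [by left|right].
have De0 : 0 < e * (1 - d1) by rewrite mulr_gt0.
exists (Num.max 0 (t - e * (1 - d1) / 2)); split.
- by rewrite le_max lexx /= ge_max ler01/=; lra.
- move=> s /andP[s0 sa]; apply: st; rewrite s0; apply: le_lt_trans sa _.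
  by rewrite gt_max t0/=; lra.
- have : t - e * (1 - d1) / 2 <= Num.max 0 (t - e * (1 - d1) / 2).
    by rewrite le_max lexx orbT.
  set a := Num.max _ _ => ta.
  by rewrite -ltrBlDl -mulrBl ltr_pdivrMr//; lra.
Qed.

Lemma crossing_value_ge1 (d1 : R) : 0 <= d1 -> d1 < 1 -> 1 <= (1 - 0) / (1 - d1).
Proof. by move=> d10 d11; rewrite ler_pdivlMr ?subr_gt0//; lra. Qed.

Lemma crossing_sat_prob p t : parameters R p -> crossing p.1 p.2 t ->
  sat_prob p.1 p.2 @ \oo --> (1 - t) / (1 - p.1).
Proof.
move=> pp ct; have [p10 p11 p20] := parametersP pp.
apply/cvgrPdist_le => e e0; have e20 : 0 < e / 2 by rewrite divr_gt0.
have [b [b01 bphi bt]] := crossing_lower p11 ct e20.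
have lo := sat_prob_phi_ge pp b01 bphi e20.
have hi : \forall n \near \oo, sat_prob p.1 p.2 n <= (1 - t) / (1 - p.1) + e.
  have [->|[a [a01 aphi at_]]] := crossing_upper p11 ct e20.
    apply: nearW => n; apply: le_trans (sat_prob_le1 _ _) _.
    by have := crossing_value_ge1 p10 p11; lra.
  apply: filterS (sat_prob_phi_le pp a01 aphi e20) => n; lra.
near=> n; rewrite ler_distlC; apply/andP; split; last by near: n.
have : (1 - b) / (1 - p.1) - e / 2 <= sat_prob p.1 p.2 n by near: n.
lra.
Unshelve. all: by end_near. Qed.

Variables (Phi : R * R -> R) (hPhi : limiting_sat_prob Phi).

Lemma Phi_le p a : parameters R p -> 0 <= a <= 1 ->
  (forall s, 0 <= s <= a -> 1 - p.1 < phi p.2 s) ->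
  Phi p <= (1 - a) / (1 - p.1).
Proof.
move=> pp a01 sa; apply/ler_addgt0Pr => e e0.
exact: cluster_le (hPhi pp) (sat_prob_phi_le pp a01 sa e0).
Qed.

Lemma Phi_ge p b : parameters R p -> 0 <= b <= 1 -> phi p.2 b < 1 - p.1 ->
  (1 - b) / (1 - p.1) <= Phi p.
Proof.
move=> pp b01 sb; apply/ler_addgt0Pr => e e0; rewrite -lerBlDr.
exact: cluster_ge (hPhi pp) (sat_prob_phi_ge pp b01 sb e0).
Qed.

Lemma Phi_le1 p : parameters R p -> Phi p <= 1.
Proof.
by move=> pp; apply: cluster_le (hPhi pp) _; apply: nearW => n; apply: sat_prob_le1.
Qed.

(** The strict inequalities behind both bounds survive small changes of the parameters, so [Phi] at
    nearby points is squeezed around the value at the crossing. *)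
Lemma crossing_Phi p t : parameters R p -> crossing p.1 p.2 t ->
  Phi @ within (parameters R) (nbhs p) --> (1 - t) / (1 - p.1).
Proof.
move=> pp ct; have [p10 p11 p20] := parametersP pp.
have D0 : 1 - p.1 != 0 by rewrite subr_eq0 gt_eqF.
have c1 : q.1 @[q --> within (parameters R) (nbhs p)] --> p.1.
  by apply: cvg_within_filter; exact: cvg_fst.
have c2 : q.2 @[q --> within (parameters R) (nbhs p)] --> p.2.
  by apply: cvg_within_filter; exact: cvg_snd.
have cD : 1 - q.1 @[q --> within (parameters R) (nbhs p)] --> 1 - p.1.
  by apply: cvgB => //; apply: cvg_cst.
have cq x : (1 - x) / (1 - q.1) @[q --> within (parameters R) (nbhs p)] -->
    (1 - x) / (1 - p.1).
  by apply: cvgM; [exact: cvg_cst|exact: cvgV].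
apply/cvgrPdist_le => e e0.
have [b [b01 bphi bt]] := crossing_lower p11 ct e0.
have hi : \forall q \near within (parameters R) (nbhs p),
    Phi q <= (1 - t) / (1 - p.1) + e.
  have [->|[a [a01 aphi at_]]] := crossing_upper p11 ct e0.
    near=> q; have pq : parameters R q by near: q; apply: withinT.
    apply: le_trans (Phi_le1 pq) _.
    by have := crossing_value_ge1 p10 p11; lra.
  have /andP[a0 a1] := a01; have [g g0 sg] := phi_gap a0 aphi.
  (* A lower bound for [phi q.2 s - (1 - q.1)] valid for all [s] up to [a] at once: since
     [s ^+ 2 <= 1], moving [p.2] to [q.2] costs at most the exponential factor. *)
  have cg : (1 - p.1 + g) * expR (- `|q.2 - p.2|) - (1 - q.1)
      @[q --> within (parameters R) (nbhs p)] --> g.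
    rewrite -[X in _ --> X](_ : (1 - p.1 + g) * expR (- `|p.2 - p.2|) - (1 - p.1) = g);
      last by rewrite subrr normr0 oppr0 expR0 mulr1; lra.
    apply: cvgB => //; apply: cvgM; first exact: cvg_cst.
    apply: (@continuous_cvg _ _ _ _ _ _ expR); first exact: continuous_expR.
    by apply: cvgN; apply: cvg_norm; apply: cvgB => //; apply: cvg_cst.
  near=> q; have pq : parameters R q by near: q; apply: withinT.
  apply: (@le_trans _ _ ((1 - a) / (1 - q.1))); last first.
    by apply: ltW; near: q; apply: (cvgr_lt _ (cq a)).
  apply: Phi_le => // s sa; have /andP[s0 sa'] := sa.
  have : 0 < (1 - p.1 + g) * expR (- `|q.2 - p.2|) - (1 - q.1).
    by near: q; apply: (cvgr_gt _ cg).
  rewrite subr_gt0 => /lt_le_trans; apply.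
  have -> : phi q.2 s = phi p.2 s * expR ((q.2 - p.2) * s ^+ 2).
    by rewrite /phi -mulrA -expRD; congr (_ * expR _); ring.
  apply: ler_pM; rewrite ?expR_ge0// ?sg//.
    by rewrite addr_ge0 ?(ltW g0)// subr_ge0 ltW.
  rewrite ler_expR lerNl -mulNr.
  have s21 : 0 <= s ^+ 2 <= 1.
    by rewrite exprn_ge0//= exprn_ile1// (le_trans sa').
  have /andP[s2 s1] := s21.
  apply: (@le_trans _ _ (`|- (q.2 - p.2)| * s ^+ 2)).
    by rewrite ler_wpM2r// ler_norm.
  by rewrite normrN ler_piMr.
have cb : phi q.2 b @[q --> within (parameters R) (nbhs p)] --> phi p.2 b.
  apply: cvgM; first exact: cvg_cst.
  apply: (@continuous_cvg _ _ _ _ _ _ expR); first exact: continuous_expR.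
  by apply: cvgM => //; exact: cvg_cst.
have cc : (1 - q.1) - phi q.2 b @[q --> within (parameters R) (nbhs p)] -->
    (1 - p.1) - phi p.2 b by apply: cvgB.
near=> q; have pq : parameters R q by near: q; apply: withinT.
rewrite ler_distlC; apply/andP; split; last by near: q.
apply: (@le_trans _ _ ((1 - b) / (1 - q.1))).
  by apply: ltW; near: q; apply: (cvgr_gt _ (cq b)).
apply: Phi_ge => //; rewrite -subr_gt0.
by near: q; apply: (cvgr_gt _ cc); rewrite subr_gt0.
Unshelve. all: by end_near. Qed.

Lemma crossing_Phi_eq p t : parameters R p -> crossing p.1 p.2 t ->
  Phi p = (1 - t) / (1 - p.1).
Proof.
move=> pp ct; have := crossing_Phi pp ct => /cvgrPdist_le h.
apply/eqP; rewrite -subr_eq0 -normr_eq0 eq_le normr_ge0 andbT.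
apply/ler_addgt0Pr => e e0; rewrite add0r distrC.
(* A property near [p] within [parameters] holds at [p] itself, so the limit is the value. *)
by have := nbhs_singleton (h e e0); apply.
Qed.

End Limits.

(** * The critical curve *)

Section GammaRoots.

Variable R : realType.
Implicit Types (d t : R).

Lemma lhsE (d1 d3 : R) t : d1 < 1 -> t < 1 ->
  lhs d1 d3 t = ln (phi d3 t / (1 - d1)).
Proof.
move=> d11 t1; rewrite /lhs -{1}[d3 * t ^+ 2]expRK -lnM ?posrE ?expR_gt0//.
  by rewrite /phi mulrAC.
by rewrite divr_gt0 ?subr_gt0.
Qed.

Lemma is_rootE (d1 d3 : R) t : d1 < 1 -> t < 1 ->
  is_root d1 d3 t <-> phi d3 t = 1 - d1.
Proof.
move=> d11 t1; have D0 : 0 < 1 - d1 by rewrite subr_gt0.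
have p0 : 0 < phi d3 t by rewrite /phi mulr_gt0 ?expR_gt0 ?subr_gt0.
split=> [[_]|e]; last by split; rewrite // lhsE// e divff ?ln1// gt_eqF.
rewrite lhsE// => /eqP; rewrite ln_eq0 ?divr_gt0// => /eqP.
by move/(congr1 (fun x => x * (1 - d1))); rewrite divfK ?mul1r// gt_eqF.
Qed.

Lemma is_derive_lhs (d1 d3 : R) t : d1 < 1 -> t < 1 ->
  is_derive t 1 (lhs d1 d3) (2 * d3 * t - (1 - t)^-1).
Proof.
move=> d11 t1; have D0 : 0 < 1 - d1 by rewrite subr_gt0.
have u0 : 0 < (1 - t) / (1 - d1) by rewrite divr_gt0// subr_gt0.
have hu : is_derive t 1 ((1 - d1)^-1 \*: (cst 1 - @id R)) (- (1 - d1)^-1).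
  apply: is_derive_eq.
  by rewrite [LHS](_ : _ = (1 - d1)^-1 * (0 - 1))//; ring.
have hq : is_derive t 1 (d3 \*: (@id R ^+ 2)) (2 * d3 * t).
  by apply: is_derive_eq; rewrite [LHS](_ : _ = d3 * (2 * t * 1))//; ring.
have u0' : 0 < ((1 - d1)^-1 \*: (cst 1 - @id R)) t.
  by rewrite [ltRHS](_ : _ = (1 - d1)^-1 * (1 - t))// mulrC.
have h := is_deriveD (is_derive1_comp (is_derive1_ln u0') hu) hq.
rewrite [X in is_derive _ _ X _](_ : _ =
    @ln R \o ((1 - d1)^-1 \*: (cst 1 - @id R)) + d3 \*: (@id R ^+ 2)); last first.
  by apply/funext => s; rewrite /lhs mulrC.
apply: is_derive_eq.
rewrite [(_ \*: _) t](_ : _ = (1 - d1)^-1 * (1 - t))//.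
by field; rewrite !gt_eqF ?subr_gt0.
Qed.

Lemma double_rootE (d1 d3 : R) t : d1 < 1 -> t < 1 ->
  is_derive t 1 (lhs d1 d3) 0 <-> 2 * d3 * t * (1 - t) = 1.
Proof.
move=> d11 t1; have h := is_derive_lhs d3 d11 t1; have t0 : 1 - t != 0.
  by rewrite gt_eqF// subr_gt0.
split=> [h0|e].
  have /eqP : 2 * d3 * t - (1 - t)^-1 = 0 by rewrite -(@derive_val _ _ _ _ _ _ _ h) (@derive_val _ _ _ _ _ _ _ h0).
  by rewrite subr_eq0 => /eqP ->; rewrite mulVf.
suff <- : 2 * d3 * t - (1 - t)^-1 = 0 by [].
by apply: (mulIf t0); rewrite mulrBl mulVf// e; lra.
Qed.

(** Strict decrease before [crit_min] makes it the smallest root on the curve. Conversely a double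
    root is [crit_min] or [crit_max], and the latter cannot be the smallest root unless the two
    coincide. *)
Lemma GammaE : Gamma R = [set p : R * R | 0 < p.1 < 1 /\ 0 <= p.2 /\
  exists t0 : R, smallest_positive_root p.1 p.2 t0 /\ double_root p.1 p.2 t0].
Proof.
apply/seteqP; split=> -[d1 d3] /=.
  move=> [/= d2 ->]; have /andP[D0 D1] := Gamma_d1_bounds d2.
  split; first by rewrite D0.
  split; first lra.
  have [m0 mM M1] := crit_order d2; have m1 := le_lt_trans mM M1.
  have rt : is_root (Gamma_d1 d3) d3 (crit_min d3).
    by apply/is_rootE => //; rewrite Gamma_d1E//; lra.
  exists (crit_min d3); split; last first.
    split=> //; apply/double_rootE => //; apply/eqP; rewrite -subr_eq0 phi_slope//.
    by rewrite subrr mulr0 mul0r.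
  split=> // s s0 rs; rewrite leNgt; apply/negP => sm.
  have s1 : s < 1 by case: rs.
  have := phi_decr_left d2 sm (lexx _); move/is_rootE: rs => -> //.
  by rewrite Gamma_d1E//; lra.
move=> [/andP[d10 d11] [d30 [t [[t0 rt tmin] [_ dt]]]]].
have t1 : t < 1 by case: rt.
have /double_rootE -/(_ d11 t1) e := dt.
(* [t * (1 - t) <= 1 / 4] turns the double root equation into this bound. *)
have d2 : 2 <= d3.
  have : 0 <= (t - 1 / 2) ^+ 2 by apply: sqr_ge0.
  have -> : (t - 1 / 2) ^+ 2 = 1 / 4 - t * (1 - t) by field.
  move=> q; have : d3 * (t * (1 - t)) <= d3 * (1 / 4) by rewrite ler_wpM2l//; lra.
  lra.
have ph : phi d3 t = 1 - d1 by apply/is_rootE.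
have [m0 mM M1] := crit_order d2.
split=> //=; rewrite Gamma_d1E//.
suff tE : t = crit_min d3 by rewrite -tE ph; lra.
have := phi_slope t d2; rewrite e subrr => /esym/eqP.
rewrite !mulf_eq0 !subr_eq0 pnatr_eq0/= => /orP[/orP[|/eqP//]|/eqP tM].
  by move=> /eqP d30'; lra.
have [mt|tm] := ltP (crit_min d3) t; last by apply/eqP; rewrite eq_le tm -tM mM.
have ph_le : phi d3 (crit_min d3) <= 1 - d1.
  by rewrite -ph -tM; apply: phi_incr_mid.
(* Between [phi d3 0 = 1] and a value of at most [1 - d1] at [crit_min], the level is already
   attained: a smaller positive root. *)
have [|c] := @IVT _ (phi d3) 0 (crit_min d3) (1 - d1) (ltW m0)
    (continuous_subspaceT (@continuous_phi _ d3)).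
  by rewrite phi0 ge_min le_max ph_le orbT/=; apply/orP; left; lra.
rewrite in_itv /= => /andP[c0 cm] ec.
have c0' : 0 < c.
  by rewrite lt_neqAle c0 andbT; apply/eqP => c0'; move: ec; rewrite -c0' phi0; lra.
have : t <= c by apply: tmin => //; apply/is_rootE => //; lra.
lra.
Qed.

(** * The critical point and its numerical value *)

Lemma sqrt_expR1 : Num.sqrt (expR 1) = expR (1 / 2) :> R.
Proof.
by rewrite -[RHS]ger0_norm ?expR_ge0// -sqrtr_sqr -expRM_natl; congr (Num.sqrt (expR _)); field.
Qed.

Lemma Gamma_d1_2 : Gamma_d1 2 = (critical_point R).1.
Proof.
rewrite /Gamma_d1 /critical_point /= sqrt_expR1 subrr mulr0 sqrtr0 !subr0.
by rewrite sqr_sqrtr//; congr (1 - expR _ / _); field.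
Qed.

(** The square root extended by [0] to negative reals is continuous, so the limit is first taken
    from both sides and then restricted. *)
Lemma cvg_Gamma_d1 : (Gamma_d1 d, d) @[d --> (2 : R)^'+] --> critical_point R.
Proof.
suff h : Gamma_d1 d @[d --> (2 : R)] --> (critical_point R).1.
  by apply: cvg_at_right_filter; exact: (@cvg_pair _ _ _ _ _ _ _ _ _ _ _ h (@cvg_id _ (nbhs (2 : R)))).
rewrite -Gamma_d1_2; apply: cvgB; first exact: cvg_cst.
have cs (g : R -> R) : g d @[d --> (2 : R)] --> g 2 ->
    Num.sqrt (g d) @[d --> (2 : R)] --> Num.sqrt (g 2).
  by move=> h; apply: (@continuous_cvg _ _ _ _ _ _ Num.sqrt) h; exact: sqrt_continuous.
have c2 : d - 2 @[d --> (2 : R)] --> (2 : R) - 2.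
  by apply: cvgB; [exact: cvg_id|exact: cvg_cst].
apply: cvgM.
  apply: (@continuous_cvg _ _ _ _ _ _ expR); first exact: continuous_expR.
  apply: cvgM; first exact: cvg_cst.
  have h : Num.sqrt d - Num.sqrt (d - 2) @[d --> (2 : R)] -->
      Num.sqrt (2 : R) - Num.sqrt (2 - 2).
    by apply: cvgB; [apply: (cs id); exact: cvg_id|apply: (cs (fun d => d - 2))].
  by under eq_fun do rewrite expr2; rewrite expr2; apply: cvgM.
apply: cvgV; first by rewrite subrr mulr0 sqrtr0 subr0.
apply: cvgB; first exact: cvg_id.
by apply: (cs (fun d => d * (d - 2))); apply: cvgM => //; exact: cvg_id.
Qed.

(** The mean value theorem is applied to [expR (- y)] times the Taylor polynomial of the
    exponential: in the derivative of this product all terms but the last cancel. *)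
Lemma expR_taylor n (x : R) : 0 < x -> exists2 c : R, 0 < c < x &
  expR (- x) * (\sum_(i < n.+1) x ^+ i / i`!%:R) =
  1 - expR (- c) * (c ^+ n / n`!%:R) * x.
Proof.
move=> x0; pose p : {poly R} := \poly_(i < n.+1) (i`!%:R)^-1.
have pE y : p.[y] = \sum_(i < n.+1) y ^+ i / i`!%:R.
  by rewrite horner_poly; apply: eq_bigr => i _; rewrite mulrC.
have p' y : p^`().[y] = p.[y] - y ^+ n / n`!%:R.
  have -> : p^`() = \poly_(i < n) (i`!%:R)^-1.
    apply/polyP => i; rewrite coef_deriv !coef_poly ltnS.
    case: ifP => _; last by rewrite mul0rn.
    by rewrite factS natrM -[LHS]mulr_natr invfM mulrAC mulVf ?mul1r// pnatr_eq0.
  rewrite pE big_ord_recr /= addrK horner_poly.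
  by apply: eq_bigr => i _; rewrite mulrC.
have dg (y : R) : is_derive y (1 : R) ((@expR R \o - @id R) * horner p)
    (- (expR (- y) * (y ^+ n / n`!%:R))).
  have he := is_derive1_comp (is_derive_expR (- y)) (is_deriveN (is_derive_id y 1)).
  have h := is_deriveM he (is_derive_poly p y).
  apply: is_derive_eq.
  rewrite [LHS](_ : _ = expR (- y) * p^`().[y] + p.[y] * (expR (- y) * -1))// p'; ring.
have [|c] := MVT x0 (fun y _ => dg y).
  apply: continuous_subspaceT => y; apply: differentiable_continuous.
  by apply/derivable1_diffP; case: (dg y).
rewrite in_itv /= => c0x e; exists c => //.
have e0 : ((expR \o - @id R) * horner p) 0 = 1.
  rewrite [LHS](_ : _ = expR (- 0) * p.[0])// oppr0 expR0 mul1r horner_poly.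
  by rewrite big_ord_recl expr0 big1 ?addr0 ?invr1 ?mulr1// => i _; rewrite /= expr0n mulr0.
have ex : ((expR \o - @id R) * horner p) x = expR (- x) * (\sum_(i < n.+1) x ^+ i / i`!%:R).
  by rewrite [LHS](_ : _ = expR (- x) * p.[x])// pE.
rewrite -ex; move: e; rewrite e0 subr0 => e; lra.
Qed.

Lemma critical_point_bounds : 1756 / 10000 <= (critical_point R).1 < 1757 / 10000.
Proof.
have -> : (critical_point R).1 = 1 - expR (1 / 2) / 2.
  by rewrite /critical_point /= sqrt_expR1.
have h12 : 0 < 1 / 2 :> R by rewrite divr_gt0.
(* Degree [6] leaves a relative error of at most [1 / 92160], enough for four decimals. *)
have [c /andP[c0 c2] e] := expR_taylor 6 h12.
have s0 : 0 < expR (1 / 2) :> R by apply: expR_gt0.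
have c1 : 0 < expR (- c) < 1 by rewrite expR_gt0/= expR_lt1 oppr_lt0.
have c6 : 0 <= c ^+ 6 <= 1 / 64.
  rewrite exprn_ge0 ?(ltW c0)//=.
  have -> : 1 / 64 = (1 / 2) ^+ 6 :> R by field.
  by rewrite lerXn2r ?nnegrE ?(ltW c0)// ltW.
have S : \sum_(i < 7) (1 / 2) ^+ i / i`!%:R =
    1 + 1 / 2 + 1 / 8 + 1 / 48 + 1 / 384 + 1 / 384 / 10 + 1 / 384 / 120 :> R.
  by rewrite !big_ord_recl big_ord0 /= /bump /= !factS fact0; field.
have f6 : 6`!%:R = 720 :> R by rewrite !factS fact0; ring.
move: e; rewrite expRN S f6.
set r := 1 + 1 / 2 + _ + _ + _ + _ + _.
set s := expR _ in s0 *. set E := expR _ in c1 *; set C := c ^+ 6 in c6 *.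
move=> e; have /andP[E0 E1] := c1; have /andP[C0 C1] := c6.
have EC : 0 <= E * C <= 1 / 64.
  by rewrite mulr_ge0 ?(ltW E0)//= -[leRHS]mul1r ler_pM// ltW.
have {}e : r = s * (1 - E * C / 1440).
  by rewrite -[LHS](mulVKf (lt0r_neq0 s0)) e; congr (_ * _); field.
have /andP[EC0 EC1] := EC; move: e; set d := E * C in EC0 EC1 * => e.
have h2 : 0 <= s * d by rewrite mulr_ge0// ltW.
have h1 : s * d <= s * (1 / 64) by rewrite ler_wpM2l// ltW.
have -> : 10000 = 100 * 100 :> R by rewrite -natrM.
have -> : 1756 = 17 * 100 + 56 :> R by rewrite -natrM -natrD.
have -> : 1757 = 17 * 100 + 57 :> R by rewrite -natrM -natrD.
have {}e : r = s - s * d / 1440 by rewrite e; ring.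
clear -e h1 h2; move: (s * d) e h1 h2 => y; rewrite /r => e h1 h2.
by apply/andP; split; lra.
Qed.

End GammaRoots.

(** * The jump across the curve and the full statement *)

Lemma Phi_jump (R : realType) (Phi : R * R -> R) (d3 : R) :
  limiting_sat_prob Phi -> 2 < d3 ->
  ~ (Phi (d, d3) @[d --> within `[0, 1[ (nbhs (Gamma_d1 d3))]
       --> Phi (Gamma_d1 d3, d3)).
Proof.
move=> hPhi d32; set D := Gamma_d1 d3; have d2 := ltW d32.
have /andP[D0 D1] : 0 < D < 1 := Gamma_d1_bounds d2.
have [m0 mM M1] := crit_order d2; have m1 := le_lt_trans mM M1.
have phm : phi d3 (crit_min d3) = 1 - D by rewrite /D Gamma_d1E//; lra.
have D01 : \forall d \near D, 0 < d < 1.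
  have : D \in `]0, 1[ by rewrite in_itv /= D0.
  by move=> /near_in_itvoo; apply: filterS => d; rewrite in_itv.
move=> cw; have cD : Phi (d, d3) @[d --> D] --> Phi (D, d3).
  move=> A /cw; rewrite /nbhs /= /within /= => wA.
  by apply: filterS2 D01 wA => d /andP[d0 d1]; apply; rewrite /= in_itv /= (ltW d0).
have cv x : (1 - x) / (1 - d) @[d --> D] --> (1 - x) / (1 - D).
  apply: cvgM; first exact: cvg_cst.
  apply: cvgV; first by rewrite subr_eq0 gt_eqF.
  by apply: cvgB; [exact: cvg_cst|exact: cvg_id].
(* For [d < D] the level [1 - d] exceeds the local minimum, so it is crossed before [crit_min]. *)
have lo : (1 - crit_min d3) / (1 - D) <= Phi (D, d3).
  apply: (ler_cvg_to (cvg_at_left_filter (cv _)) (cvg_at_left_filter cD)).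
  near=> d; have dD : d < D by near: d; apply: nbhs_left_lt.
  have /andP[d0 d1] : 0 < d < 1 by near: d; apply: cvg_within; exact: D01.
  apply: (@Phi_ge _ _ hPhi (d, d3) (crit_min d3)) => /=; first by split=> /=; [rewrite (ltW d0)|lra].
    by rewrite (ltW m0) ltW.
  by rewrite phm; lra.
(* For [d > D] the level stays below [phi] up to [crit_max]; the two bounds then contradict
   [crit_min < crit_max]. *)
have hi : Phi (D, d3) <= (1 - crit_max d3) / (1 - D).
  apply: (ler_cvg_to (cvg_at_right_filter cD) (cvg_at_right_filter (cv _))).
  near=> d; have dD : D < d by near: d; apply: nbhs_right_gt.
  have /andP[d0 d1] : 0 < d < 1 by near: d; apply: cvg_within; exact: D01.
  apply: (@Phi_le _ _ hPhi (d, d3) (crit_max d3)) => /=; first by split=> /=; [rewrite (ltW d0)|lra].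
    by rewrite (ltW M1) andbT; lra.
  move=> s /andP[s0 sM]; apply: (@lt_le_trans _ _ (phi d3 (crit_min d3))).
    by rewrite phm; lra.
  have [sm|ms] := ltP s (crit_min d3); last exact: phi_incr_mid.
  by apply/ltW/phi_decr_left.
have := le_trans lo hi; rewrite ler_pM2r ?invr_gt0 ?subr_gt0//.
have := crit_lt d32; lra.
Unshelve. all: by end_near. Qed.

Theorem proposition1p3 (R : realType) (Phi : R * R -> R)
    (hPhi : limiting_sat_prob Phi) :
  (forall p : R * R, parameters R p -> ~ (Gamma R `\ critical_point R) p ->
     sat_prob p.1 p.2 @ \oo --> Phi p) /\
  (forall p : R * R, parameters R p -> p.2 < 2 ->
     continuous_in (parameters R) Phi p) /\
  (forall d3 : R, 2 < d3 ->
     ~ {within `[0, 1[, continuous (fun d1 : R => Phi (d1, d3))}) /\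
  [set p : R * R | parameters R p /\ ~ continuous_in (parameters R) Phi p]
    = Gamma R `\ critical_point R /\
  Gamma R = [set p : R * R | 0 < p.1 < 1 /\ 0 <= p.2 /\
     exists t0 : R, smallest_positive_root p.1 p.2 t0 /\
                    double_root p.1 p.2 t0] /\
  Gamma R (critical_point R) /\
  (Gamma_d1 d3, d3) @[d3 --> (2 : R)^'+] --> critical_point R /\
  1756 / 10000 <= (critical_point R).1 < 1757 / 10000.
Proof.
have conv p : parameters R p -> ~ (Gamma R `\ critical_point R) p ->
    continuous_in (parameters R) Phi p.
  move=> pp nG; have [t ct] := crossing_exists pp nG.
  by rewrite /continuous_in (crossing_Phi_eq hPhi pp ct); exact: crossing_Phi.
have disc p : (Gamma R `\ critical_point R) p ->
    parameters R p /\ ~ continuous_in (parameters R) Phi p.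
  case: p => d1 d3 [[/= d2 ->] nc].
  have d32 : 2 < d3.
    rewrite lt_neqAle d2 andbT; apply/eqP => e; apply: nc.
    by rewrite -e Gamma_d1_2.
  have /andP[D0 D1] := Gamma_d1_bounds d2.
  split; first by split=> /=; [rewrite (ltW D0)|lra].
  (* Continuity in the plane would restrict to the slice with [d3] fixed, where the jump forbids
     it. *)
  move=> cP; apply: (Phi_jump hPhi d32).
  have c : (d, d3) @[d --> Gamma_d1 d3] --> (Gamma_d1 d3, d3).
    exact: (@cvg_pair _ _ _ _ _ _ _ _ _ _ _ cvg_id (cvg_cst d3)).
  move=> A /cP wA.
  have cA : \forall d \near Gamma_d1 d3, parameters R (d, d3) -> A (Phi (d, d3)).
    exact: c _ wA.
  suff : \forall d \near Gamma_d1 d3, d \in `[0, 1[ -> A (Phi (d, d3)) by [].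
  apply: filterS cA => d h d01; apply: h.
  by move: d01; rewrite /parameters /= in_itv /= => ->; split=> //; lra.
split.
  move=> p pp nG; have [t ct] := crossing_exists pp nG.
  by rewrite (crossing_Phi_eq hPhi pp ct); exact: crossing_sat_prob.
split.
  by move=> p pp p2; apply: conv => // -[[+ _] _]; rewrite leNgt p2.
split.
  move=> d3 d32 /subspace_continuousP cP; apply: (Phi_jump hPhi d32).
  apply: cP; rewrite /= in_itv /=.
  by have /andP[D0 ->] := Gamma_d1_bounds (ltW d32); rewrite ltW.
split.
  apply/seteqP; split=> [p [pp nc]|p /disc//].
  by apply: contrapT => nG; apply: nc; apply: conv.
split; first exact: GammaE.
split; first by split; [exact: lexx|rewrite [RHS]Gamma_d1_2].
split; first exact: cvg_Gamma_d1.
exact: critical_point_bounds.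
Qed.
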